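(* Let $p$ be an odd prime and let $G$ be a finite $p$-group with $d(G)=3$, $\Phi(G)\le Z(G)$ and $G'\cong C_p^3$. Suppose the type of $G/G'$ is $(p^{m_1},p^{m_2},p^{m_3})$ with $m_1=m_2=m_3$. Then one can choose suitable (characteristic) generators of $G$ such that the characteristic matrix of $G$ is one of the following matrices, where different types of matrix give non-isomorphic groups. Here $\nu\in\{1,\eta\}$ and $r\in\{1,2,\dots,p-2\}$. (J1) $e_{11}+e_{22}+e_{33}$; (J2) $e_{11}+e_{23}-e_{32}$; (J3) $e_{11}+\nu e_{22}+e_{23}-e_{32}$; (J4) $e_{11}+e_{22}+e_{23}-e_{32}+re_{33}$; (J5) $e_{13}+e_{22}+e_{23}+e_{31}-e_{32}$; (K1) $e_{11}+\nu e_{22}$; (K2) $e_{11}+e_{23}$; (K3) $e_{13}+e_{32}$; (K4) $e_{23}-e_{32}$; (K5) $e_{22}+e_{23}-e_{32}$; (K6) $e_{22}+e_{23}-e_{32}+re_{33}$; (L1) $0$; (L2) $e_{11}$; (L3) $e_{23}$.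
   Context: $d(G)$ is the minimal number of generators of $G$, $\Phi(G)$ the Frattini subgroup, $G'$ the derived subgroup, $C_p^3$ the elementary abelian group of order $p^3$. $F_p$ is the field with $p$ elements; $\eta$ is a fixed square non-residue modulo $p$. $e_{ij}$ denotes the $3\times3$ matrix over $F_p$ with $1$ in position $(i,j)$ and $0$ elsewhere. Characteristic matrix: let $G$ be a finite $p$-group with $d(G)=3$, $\Phi(G)\le Z(G)$, $G'\cong C_p^3$, and $G/G'$ of type $(p^{m_1},p^{m_2},p^{m_3})$, $m_1\ge m_2\ge m_3\ge1$ (i.e. $G/G'\cong C_{p^{m_1}}\times C_{p^{m_2}}\times C_{p^{m_3}}$). Choose $a_1,a_2,a_3\in G$ with $G/G'=\langle a_1G'\rangle\times\langle a_2G'\rangle\times\langle a_3G'\rangle$, $o(a_iG')=p^{m_i}$. Then $G=\langle a_1,a_2,a_3\rangle$, and $G'=\langle x,y,z\rangle$ with $x=[a_2,a_3]$, $y=[a_3,a_1]$, $z=[a_1,a_2]$. Write $a_i^{p^{m_i}}=x^{w_{i1}}y^{w_{i2}}z^{w_{i3}}$ for $i=1,2,3$. The $3\times3$ matrix $w(G)=(w_{ij})$ over $F_p$ is called a characteristic matrix of $G$, and $a_1,a_2,a_3$ a set of characteristic generators about $w(G)$ (the matrix depends on the choice of generators). A characteristic matrix together with $p,m_1,m_2,m_3$ determines $G$ up to isomorphism. *)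

(* Defs.v *)
From HB Require Import structures.
From mathcomp Require Import all_boot all_order all_algebra.
From mathcomp Require Import all_fingroup all_solvable.

Set Implicit Arguments.
Unset Strict Implicit.
Unset Printing Implicit Defensive.

Import GRing.Theory.
Local Open Scope group_scope.

Record standing_group (p m1 m2 m3 : nat) (gT : finGroupType) (G : {group gT})
  : Prop := StandingGroup {
  sg_pgroup : p.-group G;
  sg_rank : 'm(G) = 3;
  sg_Phi : 'Phi(G) \subset 'Z(G);
  sg_der_abelem : p.-abelem G^`(1);
  sg_der_card : #|G^`(1)| = (p ^ 3)%N;
  sg_exponents : [/\ 1 <= m3, m3 <= m2 & m2 <= m1]%N;
  (* [abelian_type] lists the invariant factors in decreasing order *)
  sg_type : abelian_type (G / G^`(1)) = [:: p ^ m1; p ^ m2; p ^ m3]%N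
}.

(* In a group of class 2 the conventions [a^-1 b^-1 a b] and [a b a^-1 b^-1]
   for the commutator agree.  The exponents [w i j : 'F_p] are read through
   their representatives in [0, p - 1]; this is harmless since G' has
   exponent p. *)
Record char_matrix (p m1 m2 m3 : nat) (gT : finGroupType) (G : {group gT})
    (a1 a2 a3 : gT) (w : 'M['F_p]_3) : Prop := CharMatrix {
  cm_mem : [/\ a1 \in G, a2 \in G & a3 \in G];
  cm_dprod : <[coset G^`(1) a1]> \x <[coset G^`(1) a2]>
               \x <[coset G^`(1) a3]> = G / G^`(1);
  cm_order : [/\ #[coset G^`(1) a1] = (p ^ m1)%N,
                 #[coset G^`(1) a2] = (p ^ m2)%N
               & #[coset G^`(1) a3] = (p ^ m3)%N];
  cm_power :
    let x := [~ a2, a3] in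
    let y := [~ a3, a1] in
    let z := [~ a1, a2] in
    let word (i : 'I_3) :=
      x ^+ w i (inord 0) * y ^+ w i (inord 1) * z ^+ w i (inord 2) in
    [/\ a1 ^+ (p ^ m1)%N = word (inord 0),
        a2 ^+ (p ^ m2)%N = word (inord 1)
      & a3 ^+ (p ^ m3)%N = word (inord 2)]
}.

Local Close Scope group_scope.
Local Open Scope ring_scope.

(* Indices are 1-based. *)
Definition e (p i j : nat) : 'M['F_p]_3 :=
  delta_mx (inord i.-1) (inord j.-1).

Arguments e {p} (i j)%_nat_scope.

Inductive matrix_type (p : nat) : Type :=
| J1 | J2 | J3 of 'F_p | J4 of nat | J5
| K1 of 'F_p | K2 | K3 | K4 | K5 | K6 of nat
| L1 | L2 | L3.

Arguments J1 {p}. Arguments J2 {p}. Arguments J3 {p}. Arguments J4 {p}.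
Arguments J5 {p}. Arguments K1 {p}. Arguments K2 {p}. Arguments K3 {p}.
Arguments K4 {p}. Arguments K5 {p}. Arguments K6 {p}. Arguments L1 {p}.
Arguments L2 {p}. Arguments L3 {p}.

Definition valid_type (p : nat) (eta : 'F_p) (t : matrix_type p) : Prop :=
  match t with
  | J3 nu | K1 nu => nu = 1 \/ nu = eta
  | J4 r | K6 r => (1 <= r <= p - 2)%N
  | _ => True
  end.

Definition type_matrix (p : nat) (t : matrix_type p) : 'M['F_p]_3 :=
  match t with
  | J1 => e 1 1 + e 2 2 + e 3 3
  | J2 => e 1 1 + e 2 3 - e 3 2
  | J3 nu => e 1 1 + nu *: e 2 2 + e 2 3 - e 3 2
  | J4 r => e 1 1 + e 2 2 + e 2 3 - e 3 2 + r%:R *: e 3 3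
  | J5 => e 1 3 + e 2 2 + e 2 3 + e 3 1 - e 3 2
  | K1 nu => e 1 1 + nu *: e 2 2
  | K2 => e 1 1 + e 2 3
  | K3 => e 1 3 + e 3 2
  | K4 => e 2 3 - e 3 2
  | K5 => e 2 2 + e 2 3 - e 3 2
  | K6 r => e 2 2 + e 2 3 - e 3 2 + r%:R *: e 3 3
  | L1 => 0
  | L2 => e 1 1
  | L3 => e 2 3
  end.

(* Main.v *)
(* Since p is odd, G/Phi(G) is a three-dimensional F_p-space V, the commutator
   identifies G' with the exterior square of V, and g |-> g^(p^m) induces a
   linear map V -> G'.  Replacing the generators through A in GL_3(F_p) multiplies
   the commutators x, y, z by the cofactor matrix of A, so the characteristic
   matrix w becomes det(A)^-1 A w A^T; as replacing A by c A multiplies this by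
   c^-1, characteristic matrices are bilinear forms up to congruence and
   arbitrary nonzero scalars.

   To reduce a form, take a vector of the radical of w - w^T as first basis
   vector: it splits off unless it is isotropic for w + w^T but not in its
   radical, and what remains is binary.  The types are separated by the vanishing
   of the determinants and cofactor matrices of w and w + w^T, by the ratio of the
   two determinants (J4), by the ratio of the two cofactor matrices (K6), and by
   the discriminant of w + w^T modulo squares (J3, K1). *)

Require Import Defs.
From mathcomp Require Import all_boot all_order all_algebra.
From mathcomp Require Import all_fingroup all_solvable.
From mathcomp Require Import ring zify.

Set Implicit Arguments.
Unset Strict Implicit.
Unset Printing Implicit Defensive.

Import GRing.Theory.
Local Open Scope ring_scope.

(** * Three by three matrices *)

Section Matrices3.

Variable F : fieldType.

Implicit Types A B M w : 'M[F]_3.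

Definition mx3 (a b c d e f g h i : F) : 'M[F]_3 :=
  \matrix_(k, l) nth 0 (nth [::] [:: [:: a; b; c]; [:: d; e; f]; [:: g; h; i]] k) l.

Notation o0 := (inord 0 : 'I_3).
Notation o1 := (inord 1 : 'I_3).
Notation o2 := (inord 2 : 'I_3).

Lemma ord3P (P : 'I_3 -> Prop) : P o0 -> P o1 -> P o2 -> forall i, P i.
Proof.
move=> P0 P1 P2 i; rewrite -[i]inord_val.
by case: i => -[|[|[|]]] //=.
Qed.

Lemma mx3_eta A :
  A = mx3 (A o0 o0) (A o0 o1) (A o0 o2) (A o1 o0) (A o1 o1) (A o1 o2)
          (A o2 o0) (A o2 o1) (A o2 o2).
Proof. by apply/matrixP; do 2!elim/ord3P; rewrite mxE !inordK. Qed.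

Lemma mx3E a b c d e f g h i :
  let A := mx3 a b c d e f g h i in
  ((A o0 o0 = a) * (A o0 o1 = b) * (A o0 o2 = c) *
   (A o1 o0 = d) * (A o1 o1 = e) * (A o1 o2 = f) *
   (A o2 o0 = g) * (A o2 o1 = h) * (A o2 o2 = i))%type.
Proof. by rewrite /= !mxE !inordK. Qed.

Lemma big_ord3 (V : nmodType) (f : 'I_3 -> V) :
  \sum_i f i = f o0 + f o1 + f o2.
Proof.
rewrite !big_ord_recl big_ord0 addr0 addrA.
by congr (f _ + f _ + f _); apply: val_inj; rewrite /= inordK.
Qed.

Lemma mx3M a b c d e f g h i a' b' c' d' e' f' g' h' i' :
  mx3 a b c d e f g h i *m mx3 a' b' c' d' e' f' g' h' i' =
  mx3 (a * a' + b * d' + c * g') (a * b' + b * e' + c * h') (a * c' + b * f' + c * i')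
      (d * a' + e * d' + f * g') (d * b' + e * e' + f * h') (d * c' + e * f' + f * i')
      (g * a' + h * d' + i * g') (g * b' + h * e' + i * h') (g * c' + h * f' + i * i').
Proof. by apply/matrixP; do 2!elim/ord3P; rewrite mxE big_ord3 !mx3E. Qed.

Lemma mx3T a b c d e f g h i :
  (mx3 a b c d e f g h i)^T = mx3 a d g b e h c f i.
Proof. by apply/matrixP; do 2!elim/ord3P; rewrite mxE !mx3E. Qed.

Lemma mx3Z l a b c d e f g h i : l *: mx3 a b c d e f g h i =
  mx3 (l * a) (l * b) (l * c) (l * d) (l * e) (l * f) (l * g) (l * h) (l * i).
Proof. by apply/matrixP; do 2!elim/ord3P; rewrite mxE !mx3E. Qed.

Lemma mx3N a b c d e f g h i : - mx3 a b c d e f g h i =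
  mx3 (- a) (- b) (- c) (- d) (- e) (- f) (- g) (- h) (- i).
Proof. by apply/matrixP; do 2!elim/ord3P; rewrite mxE !mx3E. Qed.

Lemma mx3D a b c d e f g h i a' b' c' d' e' f' g' h' i' :
  mx3 a b c d e f g h i + mx3 a' b' c' d' e' f' g' h' i' =
  mx3 (a + a') (b + b') (c + c') (d + d') (e + e') (f + f')
      (g + g') (h + h') (i + i').
Proof. by apply/matrixP; do 2!elim/ord3P; rewrite mxE !mx3E. Qed.

Lemma mx3_0 : 0 = mx3 0 0 0 0 0 0 0 0 0.
Proof. by apply/matrixP; do 2!elim/ord3P; rewrite mxE !mx3E. Qed.

Lemma mx3_eq0 a b c d e f g h i : (mx3 a b c d e f g h i == 0) =
  [&& a == 0, b == 0, c == 0, d == 0, e == 0, f == 0, g == 0, h == 0 & i == 0].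
Proof.
apply/eqP/idP => [E|].
  have := E; rewrite mx3_0 => /matrixP M.
  have := (M o0 o0, M o0 o1, M o0 o2, M o1 o0, M o1 o1, M o1 o2, M o2 o0, M o2 o1, M o2 o2).
  by rewrite !mx3E => -[[[[[[[[]]]]]]]] -> -> -> -> -> -> -> -> ->; rewrite !eqxx.
by do 8![case/andP=> /eqP->]; move/eqP->; rewrite -mx3_0.
Qed.

Lemma mx3_det a b c d e f g h i : \det (mx3 a b c d e f g h i) =
  a * (e * i - f * h) - b * (d * i - f * g) + c * (d * h - e * g).
Proof.
rewrite (expand_det_row _ 0) !big_ord_recl big_ord0 /cofactor.
rewrite !(expand_det_row _ 0) !big_ord_recl !big_ord0 /cofactor !det_mx11.
rewrite !mxE /= /bump /= !add0n !addr0; ring.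
Qed.

(* Row [i] is the cross product of the other two rows of [A], in cyclic order. *)
Definition cofmx A : 'M[F]_3 :=
  mx3 (A o1 o1 * A o2 o2 - A o1 o2 * A o2 o1)
      (A o1 o2 * A o2 o0 - A o1 o0 * A o2 o2)
      (A o1 o0 * A o2 o1 - A o1 o1 * A o2 o0)
      (A o2 o1 * A o0 o2 - A o2 o2 * A o0 o1)
      (A o2 o2 * A o0 o0 - A o2 o0 * A o0 o2)
      (A o2 o0 * A o0 o1 - A o2 o1 * A o0 o0)
      (A o0 o1 * A o1 o2 - A o0 o2 * A o1 o1)
      (A o0 o2 * A o1 o0 - A o0 o0 * A o1 o2)
      (A o0 o0 * A o1 o1 - A o0 o1 * A o1 o0).

(** [cofmx A] is the transposed adjugate, that is, the matrix of the exterior square of [A]; it is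
    therefore multiplicative without reversing the order. *)
Lemma cofmxM A B : cofmx (A *m B) = cofmx A *m cofmx B.
Proof.
rewrite (mx3_eta A) (mx3_eta B) mx3M /cofmx !mx3E mx3M.
by congr mx3; ring.
Qed.

Lemma cofmxT A : cofmx A^T = (cofmx A)^T.
Proof. by rewrite /cofmx mx3T !mxE; congr mx3; ring. Qed.

Lemma cofmxZ c A : cofmx (c *: A) = c ^+ 2 *: cofmx A.
Proof. by rewrite /cofmx mx3Z !mxE; congr mx3; ring. Qed.

Lemma mul_tr_cofmx A : A^T *m cofmx A = (\det A)%:M.
Proof.
rewrite (mx3_eta A) mx3_det /cofmx !mx3E mx3T mx3M -scalemx1.
have -> : (1%:M : 'M[F]_3) = mx3 1 0 0 0 1 0 0 0 1.
  by apply/matrixP; do 2!elim/ord3P; rewrite mxE mx3E -val_eqE /= !inordK.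
by rewrite mx3Z; congr mx3; ring.
Qed.

(** If [\det A] is nonzero, [\det A * \det (cofmx A) = \det A ^+ 3] is nonzero too. If [\det A = 0]
    and [cofmx A] were invertible, [A^T *m cofmx A = 0] would force [A = 0] and hence
    [cofmx A = 0]. *)
Lemma cofmx_unit A : (cofmx A \in unitmx) = (A \in unitmx).
Proof.
have detE := congr1 determinant (mul_tr_cofmx A).
rewrite det_mulmx det_tr det_scalar in detE.
rewrite !unitmxE !unitfE; have [d0|dn0] := eqVneq (\det A) 0.
  apply/negbTE; rewrite negbK; apply/eqP.
  apply/eqP; apply: contraT => cn0.
  have /(congr1 (mulmx^~ (invmx (cofmx A)))) := mul_tr_cofmx A.
  rewrite mulmxK ?unitmxE ?unitfE // d0 -scalemx1 scale0r mul0mx => A0.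
  have {}A0 : A = 0 by rewrite -[A]trmxK A0 trmx0.
  move: cn0; rewrite A0 /cofmx !mxE !mul0r subr0 -mx3_0.
  by rewrite det0 eqxx.
apply/eqP=> c0; move: detE; rewrite c0 mulr0 => /esym/eqP.
by rewrite expf_eq0 (negbTE dn0) andbF.
Qed.

Definition cross (u v : 'rV[F]_3) : 'rV[F]_3 :=
  \row_j nth 0 [:: u 0 o1 * v 0 o2 - u 0 o2 * v 0 o1;
                   u 0 o2 * v 0 o0 - u 0 o0 * v 0 o2;
                   u 0 o0 * v 0 o1 - u 0 o1 * v 0 o0] j.

(** The bilinear expansion behind [comm_cross]. With [d i] the coordinates of the basic commutators
    x, y, z, the three values of [r] are the coordinates of the commutators of [a1], [a2], [a3] with
    an element of coordinates [v]. *)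
Lemma cross_expand (u v : 'rV[F]_3) (d := fun i : 'I_3 => delta_mx 0 i : 'rV[F]_3)
    (r := fun s0 s1 s2 : 'rV[F]_3 => - (v 0 o0 *: s0 + v 0 o1 *: s1 + v 0 o2 *: s2)) :
  u 0 o0 *: r 0 (- d o2) (d o1) + u 0 o1 *: r (d o2) 0 (- d o0) +
    u 0 o2 *: r (- d o1) (d o0) 0 = cross u v.
Proof.
apply/rowP; elim/ord3P; rewrite !mxE -!val_eqE /= !inordK //=; ring.
Qed.

Lemma row_cofmx A :
  (row o0 (cofmx A) = cross (row o1 A) (row o2 A)) *
  (row o1 (cofmx A) = cross (row o2 A) (row o0 A)) *
  (row o2 (cofmx A) = cross (row o0 A) (row o1 A)).
Proof.
by do 2?split; apply/rowP; elim/ord3P; rewrite mxE mx3E !mxE !inordK.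
Qed.

End Matrices3.

(** * Bilinear forms up to congruence and scaling *)

(** The units are the powers of one generator, and a nonsquare is an odd power of it. So [d] itself
    is a square if its exponent is even, and [d / eta] is one if it is odd. *)
Lemma finField_nonsquare (F : finFieldType) (eta d : F) :
  (forall u, u ^+ 2 <> eta) -> exists u, d = u ^+ 2 \/ d = eta * u ^+ 2.
Proof.
move=> nsq; have [->|d0] := eqVneq d 0; first by exists 0; left; rewrite expr0n.
have eta0 : eta != 0.
  by apply/eqP=> E; apply: (nsq 0); rewrite E expr0n.
have /cyclicP[g gE] := field_unit_group_cyclic [group of [set: {unit F}]].
have pow (x : F) : x != 0 -> exists i, x = FinRing.uval g ^+ i.
  rewrite -unitfE => ux.
  have : FinRing.Unit ux \in <[g]>%g by rewrite -gE inE.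
  by case/cycleP=> i /(congr1 val) /= ->; exists i; rewrite FinRing.val_unitX.
have [i iE] := pow _ d0; have [j jE] := pow _ eta0.
have g0 : FinRing.uval g != 0 by rewrite -unitfE; apply: (valP g).
have jodd : odd j.
  apply/negPn/negP=> /negPf evj; apply: (nsq (FinRing.uval g ^+ j./2)).
  by rewrite -exprM muln2 jE -{2}(odd_double_half j) evj.
rewrite iE; case iodd: (odd i); last first.
  exists (FinRing.uval g ^+ i./2); left.
  by rewrite -exprM muln2 -{1}(odd_double_half i) iodd.
exists (FinRing.uval g ^+ i./2 / FinRing.uval g ^+ j./2); right.
rewrite expr_div_n -!exprM !muln2 -{1}(odd_double_half i) iodd.
rewrite jE -{1}(odd_double_half j) jodd !exprD.
by field; rewrite expf_neq0.
Qed.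

(* If squares were closed under [+ 1], then every element of the prime field
   would be a square. *)
Lemma Fp_two_squares_nonsquare (p : nat) (eta : 'F_p) :
  prime p -> (forall u, u ^+ 2 <> eta) ->
  exists u v : 'F_p, forall w, w ^+ 2 <> u ^+ 2 + v ^+ 2.
Proof.
move=> p_pr nsq.
suff [u /forallP nu] : exists u : 'F_p, [forall w : 'F_p, w ^+ 2 != u ^+ 2 + 1 ^+ 2].
  by exists u, 1 => w; apply/eqP.
apply/existsP; apply: contraT; rewrite negb_exists => /forallP clos.
have sq n : exists u : 'F_p, u ^+ 2 = n%:R.
  elim: n => [|n [u uE]]; first by exists 0; rewrite expr0n.
  have := clos u; rewrite negb_forall => /existsP[w]; rewrite negbK => /eqP wE.
  by exists w; rewrite wE uE expr1n -natr1.
by have [u] := sq eta; rewrite natr_Zp => /nsq.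
Qed.

(** * Reduction of a form to normal form *)

Section Congruence.

Variable F : fieldType.

Implicit Types A B w : 'M[F]_3.

Definition scaled_congr w w' :=
  exists A l, [/\ A \in unitmx, l != 0 & w' = l *: (A *m w *m A^T)].

Lemma scaled_congr_refl w : scaled_congr w w.
Proof.
exists 1%:M, 1; split; rewrite ?unitmx1 ?oner_eq0 //.
by rewrite trmx1 mulmx1 mul1mx scale1r.
Qed.

Lemma scaled_congr_trans w1 w2 w3 :
  scaled_congr w1 w2 -> scaled_congr w2 w3 -> scaled_congr w1 w3.
Proof.
move=> [A [l [uA l0 ->]]] [B [k [uB k0 ->]]].
exists (B *m A), (k * l); split; rewrite ?unitmx_mul ?uB ?mulf_neq0 //.
by rewrite -scalemxAr -scalemxAl scalerA trmx_mul !mulmxA.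
Qed.

Lemma scaled_congr_mx3 a b c d e f g h i l w w' :
  a * (e * i - f * h) - b * (d * i - f * g) + c * (d * h - e * g) != 0 ->
  l != 0 -> w' = l *: (mx3 a b c d e f g h i *m w *m (mx3 a b c d e f g h i)^T) ->
  scaled_congr w w'.
Proof.
by move=> d0 l0 ->; exists (mx3 a b c d e f g h i), l; rewrite unitmxE unitfE mx3_det.
Qed.

(* Congruence by the block matrix [[1, 0, 0], [0, al, be], [0, ga, de]]. *)
Lemma scaled_congr_block al be ga de a q r s t q' r' s' t' :
  al * de - be * ga != 0 ->
  q' = al ^+ 2 * q + al * be * (r + s) + be ^+ 2 * t ->
  r' = al * ga * q + al * de * r + be * ga * s + be * de * t ->
  s' = al * ga * q + be * ga * r + al * de * s + be * de * t ->
  t' = ga ^+ 2 * q + ga * de * (r + s) + de ^+ 2 * t ->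
  scaled_congr (mx3 a 0 0 0 q r 0 s t) (mx3 a 0 0 0 q' r' 0 s' t').
Proof.
move=> d0 -> -> -> ->.
apply: (@scaled_congr_mx3 1 0 0 0 al be 0 ga de 1); rewrite ?oner_eq0 //.
  by rewrite !mul0r subr0 addr0 mul1r.
by rewrite mx3T !mx3M mx3Z; congr mx3; ring.
Qed.

Hypothesis two_neq0 : 2 != 0 :> F.

(** Completing the square diagonalises the symmetric part of the block, while the alternating part
    is only multiplied by the determinant of the base change. If [q = t = 0], the sum of the two
    basis vectors has value [r + s]. The clause [x = 0 -> y = 0] says that [x] vanishes only
    together with the whole symmetric part. *)
Lemma scaled_congr_block_diag a q r s t :
  exists x c y, (x = 0 -> y = 0) /\
    scaled_congr (mx3 a 0 0 0 q r 0 s t) (mx3 a 0 0 0 x c 0 (- c) y).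
Proof.
have nz q1 r1 s1 t1 : q1 != 0 -> exists x c y, (x = 0 -> y = 0) /\
    scaled_congr (mx3 a 0 0 0 q1 r1 0 s1 t1) (mx3 a 0 0 0 x c 0 (- c) y).
  move=> q0; exists q1, ((r1 - s1) / 2), (t1 - ((r1 + s1) / 2) ^+ 2 / q1).
  split; first by move/eqP; rewrite (negbTE q0).
  apply: (@scaled_congr_block 1 0 (- ((r1 + s1) / 2) / q1) 1).
  - by rewrite mul0r subr0 mulr1 oner_eq0.
  - by ring.
  - by field; rewrite ?q0 ?two_neq0.
  - by field; rewrite ?q0 ?two_neq0.
  - by field; rewrite ?q0 ?two_neq0.
have [q0|q0] := eqVneq q 0; last exact: nz.
have [t0|t0] := eqVneq t 0; last first.
  have [x [c [y [xy E]]]] := nz t s r q t0; exists x, c, y; split=> //.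
  apply: scaled_congr_trans E.
  by apply: (@scaled_congr_block 0 1 1 0);
    rewrite ?mul0r ?mulr1 ?sub0r ?oppr_eq0 ?oner_eq0 //; ring.
have [rs|rs] := eqVneq (r + s) 0.
  exists 0, r, 0; split=> //; rewrite q0 t0 -(addr0_eq rs).
  exact: scaled_congr_refl.
have [x [c [y [xy E]]]] := nz (r + s) r s 0 rs; exists x, c, y; split=> //.
apply: scaled_congr_trans E; rewrite q0 t0.
by apply: (@scaled_congr_block 1 1 0 1); rewrite ?mulr1 ?mulr0 ?subr0 ?oner_eq0 //; ring.
Qed.

(* The first basis vector is taken in the radical of [w - w^T]; if [w] is
   symmetric, that radical is everything and an anisotropic vector is preferred. *)
Lemma scaled_congr_radical w : exists a b c q r s t,
  (a = 0 -> r <> s \/ mx3 a b c b q r c s t = 0) /\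
  scaled_congr w (mx3 a b c b q r c s t).
Proof.
rewrite (mx3_eta w).
move: (w _ _) (w _ _) (w _ _) (w _ _) (w _ _) (w _ _) (w _ _) (w _ _) (w _ _).
move=> w33 w32 w31 w23 w22 w21 w13 w12 w11.
(* The row [(w23 - w32, w31 - w13, w12 - w21)] spans the kernel of [w - w^T] when it is nonzero. A
   nonzero entry decides which two unit vectors complete it to a basis, and the same entry is then
   the difference [r - s]. *)
have [n1|n1] := eqVneq w23 w32; last first.
  do 7 eexists; split; first by move=> _; left; apply/eqP; exact: n1.
  apply: (@scaled_congr_mx3 (w23 - w32) (w31 - w13) (w12 - w21) 0 1 0 0 0 1 1);
    rewrite ?oner_eq0 //.
    by rewrite [X in X != 0](_ : _ = w23 - w32) ?subr_eq0 //; ring.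
  by rewrite mx3T !mx3M mx3Z; congr mx3; first [reflexivity | ring].
have [n2|n2] := eqVneq w31 w13; last first.
  do 7 eexists; split; first by move=> _; left; apply/eqP; exact: n2.
  apply: (@scaled_congr_mx3 (w23 - w32) (w31 - w13) (w12 - w21) 0 0 1 1 0 0 1);
    rewrite ?oner_eq0 //.
    by rewrite [X in X != 0](_ : _ = w31 - w13) ?subr_eq0 //; ring.
  by rewrite mx3T !mx3M mx3Z; congr mx3; first [reflexivity | ring].
have [n3|n3] := eqVneq w12 w21; last first.
  do 7 eexists; split; first by move=> _; left; apply/eqP; exact: n3.
  apply: (@scaled_congr_mx3 (w23 - w32) (w31 - w13) (w12 - w21) 1 0 0 0 1 0 1);
    rewrite ?oner_eq0 //.
    by rewrite [X in X != 0](_ : _ = w12 - w21) ?subr_eq0 //; ring.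
  by rewrite mx3T !mx3M mx3Z; congr mx3; first [reflexivity | ring].
rewrite n1 n2 n3 {n1 n2 n3}.
(* Now [w] is symmetric, and any vector [(a, b, c)] of nonzero value [v] may come first. The unit
   vectors and their pairwise sums are tried; if all have value zero then [w = 0] by polarisation,
   as 2 is invertible. *)
have conj a b c d e f g h i : let v := a ^+ 2 * w11 + b ^+ 2 * w22 + c ^+ 2 * w33 +
    2 * (a * b * w21 + a * c * w13 + b * c * w32) in
  a * (e * i - f * h) - b * (d * i - f * g) + c * (d * h - e * g) = 1 ->
  v != 0 -> exists a b c q r s t,
  (a = 0 -> r <> s \/ mx3 a b c b q r c s t = 0) /\
  scaled_congr (mx3 w11 w21 w13 w21 w22 w32 w13 w32 w33) (mx3 a b c b q r c s t).
  move=> v d1 v0; do 7 eexists; split; last first.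
    apply: (@scaled_congr_mx3 a b c d e f g h i 1); rewrite ?oner_eq0 ?d1 ?oner_eq0 //.
    by rewrite mx3T !mx3M mx3Z; congr mx3; first [reflexivity | ring].
  by move/eqP; rewrite (_ : _ * _ = v) ?(negbTE v0) // /v; ring.
have [d1|d1] := eqVneq w11 0; last first.
  apply: (conj 1 0 0 0 1 0 0 0 1); first by ring.
  by rewrite [X in X != 0](_ : _ = w11) //; ring.
have [d2|d2] := eqVneq w22 0; last first.
  apply: (conj 0 1 0 0 0 1 1 0 0); first by ring.
  by rewrite [X in X != 0](_ : _ = w22) //; ring.
have [d3|d3] := eqVneq w33 0; last first.
  apply: (conj 0 0 1 1 0 0 0 1 0); first by ring.
  by rewrite [X in X != 0](_ : _ = w33) //; ring.
have [e1|e1] := eqVneq w21 0; last first.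
  apply: (conj 1 1 0 0 1 0 0 0 1); first by ring.
  by rewrite d1 d2 d3 [X in X != 0](_ : _ = 2 * w21) ?mulf_neq0 //; ring.
have [e2|e2] := eqVneq w13 0; last first.
  apply: (conj 1 0 1 0 1 0 0 0 1); first by ring.
  by rewrite d1 d2 d3 [X in X != 0](_ : _ = 2 * w13) ?mulf_neq0 //; ring.
have [e3|e3] := eqVneq w32 0; last first.
  apply: (conj 0 1 1 0 0 1 1 0 0); first by ring.
  by rewrite d1 d2 d3 [X in X != 0](_ : _ = 2 * w32) ?mulf_neq0 //; ring.
exists 0, 0, 0, 0, 0, 0, 0; split; first by move=> _; right; rewrite -mx3_0.
by rewrite d1 d2 d3 e1 e2 e3; apply: scaled_congr_refl.
Qed.

(** Since the first row and the first column agree, one base change clears both; the scalar [a^-1]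
    then turns the corner into 1. *)
Lemma scaled_congr_split a b c q r s t : a != 0 ->
  exists q' r' s' t',
  scaled_congr (mx3 a b c b q r c s t) (mx3 1 0 0 0 q' r' 0 s' t').
Proof.
move=> a0; do 4 eexists.
apply: (@scaled_congr_mx3 1 0 0 (- b / a) 1 0 (- c / a) 0 1 a^-1); rewrite ?invr_eq0 //.
  by rewrite [X in X != 0](_ : _ = 1) ?oner_eq0 //; ring.
by rewrite mx3T !mx3M mx3Z; congr mx3; first [reflexivity | field].
Qed.

(** The first basis vector is isotropic and pairs nontrivially with the other two. These are
    recombined so that the second is orthogonal to it and the third pairs to 1 with it. Adding
    multiples of the first vector then removes the last diagonal entry and the symmetric part of the
    entries [r'], [s']; what is left of them is [k], nonzero because [r <> s]. *)
Lemma scaled_congr_hyperbolic b c q r s t : r <> s -> b != 0 \/ c != 0 ->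
  exists d k, k != 0 /\
  scaled_congr (mx3 0 b c b q r c s t) (mx3 0 0 1 0 d k 1 (- k) 0).
Proof.
move=> rs bc; suff [q' [r' [s' [t' [rs' E]]]]] : exists q' r' s' t', r' != s' /\
    scaled_congr (mx3 0 b c b q r c s t) (mx3 0 0 1 0 q' r' 1 s' t').
  exists q', ((r' - s') / 2); split.
    by rewrite mulf_neq0 ?invr_eq0 ?subr_eq0.
  apply: scaled_congr_trans E _.
  apply: (@scaled_congr_mx3 1 0 0 (- ((r' + s') / 2)) 1 0 (- t' / 2) 0 1 1);
    rewrite ?oner_eq0 //.
    by rewrite [X in X != 0](_ : _ = 1) ?oner_eq0 //; ring.
  by rewrite mx3T !mx3M mx3Z; congr mx3; field.
move/eqP: rs => rs.
have [c0|c0] := eqVneq c 0.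
  have b0 : b != 0 by case: bc; rewrite // c0 eqxx.
  exists t, (s / b), (r / b), (q / b ^+ 2); split.
    by rewrite (inj_eq (mulIf _)) ?invr_eq0 // eq_sym.
  apply: (@scaled_congr_mx3 1 0 0 0 0 1 0 b^-1 0 1); rewrite ?oner_eq0 //.
    by rewrite [X in X != 0](_ : _ = - b^-1) ?oppr_eq0 ?invr_eq0 //; ring.
  by rewrite c0 mx3T !mx3M mx3Z; congr mx3; field.
do 4 eexists; split; last first.
  apply: (@scaled_congr_mx3 1 0 0 0 c (- b) 0 0 c^-1 1); rewrite ?oner_eq0 //.
    by rewrite [X in X != 0](_ : _ = 1) ?oner_eq0 //; field.
  by rewrite mx3T !mx3M mx3Z; congr mx3; first [reflexivity | field].
rewrite -subr_eq0 (_ : _ - _ = r - s); first by rewrite subr_eq0.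
by field.
Qed.

Lemma scaled_congr_J5 (d k : F) : d != 0 -> k != 0 ->
  scaled_congr (mx3 0 0 1 0 d k 1 (- k) 0) (mx3 0 0 1 0 1 1 1 (- 1) 0).
Proof.
move=> d0 k0; apply: (@scaled_congr_mx3 (k / d) 0 0 0 d^-1 0 0 0 k^-1 d) => //.
  by rewrite !mul0r !subr0 addr0 ?mulf_neq0 ?invr_eq0.
by rewrite mx3T !mx3M mx3Z; congr mx3; field; rewrite ?d0 ?k0.
Qed.

(** On the plane of the first two basis vectors, left and right pairing with the third vector are
    independent functionals; the new basis of the plane is dual to them. *)
Lemma scaled_congr_K3 (k : F) : k != 0 ->
  scaled_congr (mx3 0 0 1 0 0 k 1 (- k) 0) (mx3 0 0 1 0 0 0 0 1 0).
Proof.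
move=> k0.
apply: (@scaled_congr_mx3 2^-1 (2 * k)^-1 0 2^-1 (- (2 * k)^-1) 0 0 0 1 1);
  rewrite ?oner_eq0 //.
  rewrite [X in X != 0](_ : _ = - (2 * k)^-1) ?oppr_eq0 ?invr_eq0 ?mulf_neq0 //.
  by field; rewrite k0.
by rewrite mx3T !mx3M mx3Z; congr mx3; field; rewrite ?k0 ?two_neq0.
Qed.

(** The block has determinant zero and a hyperbolic symmetric part, so in a basis of isotropic
    vectors one of its two off-diagonal entries must vanish. This is why the parameter [-1] is
    absent from [J4] and [K6]. *)
Lemma scaled_congr_isotropic a :
  scaled_congr (mx3 a 0 0 0 1 1 0 (- 1) (- 1)) (mx3 a 0 0 0 0 1 0 0 0).
Proof.
have four0 : 4 != 0 :> F by rewrite (natrM _ 2 2) mulf_neq0.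
apply: (@scaled_congr_block 1 (- 1) 4^-1 4^-1).
- rewrite [X in X != 0](_ : _ = 2^-1) ?invr_eq0 //.
  by field; rewrite four0 two_neq0.
- by ring.
- by field.
- by field.
- by field.
Qed.

Variable eta : F.
Hypothesis nonsquare : forall u, u ^+ 2 <> eta.
Hypothesis square_classes : forall d : F, exists u, d = u ^+ 2 \/ d = eta * u ^+ 2.
Hypothesis two_squares : exists u v : F, forall t : F, t ^+ 2 <> u ^+ 2 + v ^+ 2.

Lemma nonsquare_neq0 : eta != 0.
Proof. by apply/eqP=> E; apply: (nonsquare (u := 0)); rewrite E expr0n. Qed.

(** If a coefficient is a square, one variable suffices. Otherwise both are [eta] times squares, and
    the form is [eta] times a sum of two squares after rescaling; a nonsquare sum
    [P ^+ 2 + Q ^+ 2 = eta * k ^+ 2] then yields the solution. *)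
Lemma binary_form_represents1 (x y : F) : x != 0 -> y != 0 ->
  exists a b, x * a ^+ 2 + y * b ^+ 2 = 1.
Proof.
move=> x0 y0; have eta0 := nonsquare_neq0.
have sq0 (u : F) : u ^+ 2 != 0 -> u != 0 by rewrite expf_eq0.
have [u [xE|xE]] := square_classes x; have [v [yE|yE]] := square_classes y.
- move: x0; rewrite xE => /sq0 u0.
  by exists u^-1, 0; field.
- move: x0; rewrite xE => /sq0 u0.
  by exists u^-1, 0; field.
- move: y0; rewrite yE => /sq0 v0.
  by exists 0, v^-1; field.
have u0 : u != 0 by apply: sq0; apply: contraNneq x0 => E; rewrite xE E mulr0.
have v0 : v != 0 by apply: sq0; apply: contraNneq y0 => E; rewrite yE E mulr0.
have [P [Q PQ]] := two_squares.
have [k [kE|kE]] := square_classes (P ^+ 2 + Q ^+ 2); first by case: (PQ k).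
have k0 : k != 0.
  by apply/eqP=> E; apply: (PQ 0); rewrite kE E expr0n mulr0.
exists (P / (eta * k * u)), (Q / (eta * k * v)).
rewrite xE yE (_ : _ + _ = (P ^+ 2 + Q ^+ 2) / (eta * k ^+ 2)).
  by rewrite kE mulfV ?mulf_neq0 ?expf_neq0.
by field; rewrite eta0 k0 u0 v0.
Qed.

(** After diagonalisation, [x] is reduced modulo squares if [y = 0], and replaced by the represented
    value 1 if [x] and [y] are both nonzero. Rescaling the last basis vector finally turns a nonzero
    [c] into 1. All these changes fix the corner [a]. *)
Lemma scaled_congr_block_nf a q r s t : exists x c y : F,
  [/\ c = 0 \/ c = 1,
      [\/ x = 0 /\ y = 0, (x = 1 \/ x = eta) /\ y = 0 | x = 1 /\ y != 0]
    & scaled_congr (mx3 a 0 0 0 q r 0 s t) (mx3 a 0 0 0 x c 0 (- c) y)].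
Proof.
have [x [c [y [xy E]]]] := scaled_congr_block_diag a q r s t.
have [x' [y' [xyP {}E]]] : exists x' y',
    [\/ x' = 0 /\ y' = 0, (x' = 1 \/ x' = eta) /\ y' = 0 | x' = 1 /\ y' != 0]
  /\ exists c', scaled_congr (mx3 a 0 0 0 q r 0 s t) (mx3 a 0 0 0 x' c' 0 (- c') y').
  have [x0|x0] := eqVneq x 0.
    by exists 0, 0; split; [constructor 1 | exists c; move: E; rewrite xy // x0].
  have [y0|y0] := eqVneq y 0.
    have [u xE] := square_classes x.
    have u0 : u != 0.
      by apply: contra_neq x0 => u0; case: xE => ->; rewrite u0 expr0n ?mulr0.
    have [nu nuP {}xE] : exists2 nu, nu = 1 \/ nu = eta & x = nu * u ^+ 2.
      by case: xE => ->; [exists 1 | exists eta]; rewrite ?mul1r; auto.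
    exists nu, 0; split; first by constructor 2.
    exists (c / u); apply: scaled_congr_trans E _; rewrite y0 xE.
    apply: (@scaled_congr_block u^-1 0 0 1); try by field.
    by rewrite mulr1 mul0r subr0 invr_eq0.
  have [al [be ab]] := binary_form_represents1 x0 y0.
  exists 1, (x * y); split; first by constructor 3; rewrite mulf_neq0.
  exists c; apply: scaled_congr_trans E _.
  (* The second row is orthogonal to the first for the form [diag(x, y)], and the determinant
     [x * al ^+ 2 + y * be ^+ 2] is 1, so the alternating part [c] is kept. *)
  apply: (@scaled_congr_block al be (- (y * be)) (x * al)).
  - by rewrite (_ : _ - _ = 1) ?oner_eq0 // -ab; ring.
  - by rewrite -[LHS]ab; ring.
  - by rewrite -[in LHS](mulr1 c) -ab; ring.
  - by rewrite -[in LHS](mulr1 (- c)) -ab; ring.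
  - by rewrite -[in LHS](mulr1 (x * y)) -ab; ring.
case: E => k E; have [k0|k0] := eqVneq k 0.
  by exists x', 0, y'; split; [left | | move: E; rewrite k0].
exists x', 1, (y' / k ^+ 2); split; first by right.
  case: xyP => -[xP yP]; [constructor 1 | constructor 2 | constructor 3];
    by split; rewrite // ?mulf_neq0 ?invr_eq0 ?expf_neq0 // yP mul0r.
apply: scaled_congr_trans E _; apply: (@scaled_congr_block 1 0 0 k^-1); try by field.
by rewrite mul1r mul0r subr0 invr_eq0.
Qed.

(** Writing [y] as a sum of two squares gives a similitude of the first two coordinates with factor
    [y]; the scalar [y^-1] then makes all three diagonal entries 1. *)
Lemma scaled_congr_J1 (y : F) : y != 0 ->
  scaled_congr (mx3 1 0 0 0 1 0 0 0 y) (mx3 1 0 0 0 1 0 0 0 1).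
Proof.
move=> y0; have yV0 : y^-1 != 0 by rewrite invr_eq0.
have [al [be ab]] := binary_form_represents1 yV0 yV0.
have {}ab : al ^+ 2 + be ^+ 2 = y by rewrite -[RHS]mulr1 -ab; field.
apply: (@scaled_congr_mx3 al be 0 (- be) al 0 0 0 1 y^-1) => //.
  by rewrite [X in X != 0](_ : _ = y) // -ab; ring.
by rewrite mx3T !mx3M mx3Z; congr mx3; move: y0 {yV0}; rewrite -ab => y0; field.
Qed.

Lemma scaled_congr_K1 (y : F) : y != 0 -> exists2 nu, nu = 1 \/ nu = eta &
  scaled_congr (mx3 0 0 0 0 1 0 0 0 y) (mx3 1 0 0 0 nu 0 0 0 0).
Proof.
move=> y0; have [u yE] := square_classes y.
have u0 : u != 0.
  by apply: contra_neq y0 => u0; case: yE => ->; rewrite u0 expr0n ?mulr0.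
have [nu nuP {}yE] : exists2 nu, nu = 1 \/ nu = eta & y = nu * u ^+ 2.
  by case: yE => ->; [exists 1 | exists eta]; rewrite ?mul1r; auto.
exists nu => //; apply: (@scaled_congr_mx3 0 1 0 0 0 u^-1 1 0 0 1); rewrite ?oner_eq0 //.
  by rewrite [X in X != 0](_ : _ = u^-1) ?invr_eq0 //; ring.
by rewrite yE mx3T !mx3M mx3Z; congr mx3; field.
Qed.

Lemma scaled_congr_K5 (x : F) : x != 0 ->
  scaled_congr (mx3 0 0 0 0 x 1 0 (- 1) 0) (mx3 0 0 0 0 1 1 0 (- 1) 0).
Proof.
move=> x0; apply: (@scaled_congr_mx3 1 0 0 0 1 0 0 0 x x^-1); rewrite ?invr_eq0 //.
  by rewrite [X in X != 0](_ : _ = x) //; ring.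
by rewrite mx3T !mx3M mx3Z; congr mx3; field.
Qed.

Lemma scaled_congr_L2 (x : F) : x != 0 ->
  scaled_congr (mx3 0 0 0 0 x 0 0 0 0) (mx3 1 0 0 0 0 0 0 0 0).
Proof.
move=> x0; apply: (@scaled_congr_mx3 0 1 0 0 0 1 1 0 0 x^-1); rewrite ?invr_eq0 //.
  by rewrite [X in X != 0](_ : _ = 1) ?oner_eq0 //; ring.
by rewrite mx3T !mx3M mx3Z; congr mx3; field.
Qed.

End Congruence.

Lemma scaled_congr_sym (F : fieldType) (w w' : 'M[F]_3) :
  scaled_congr w w' -> scaled_congr w' w.
Proof.
move=> [A [l [uA l0 ->]]]; exists (invmx A), l^-1; split.
- by rewrite unitmx_inv.
- by rewrite invr_eq0.
rewrite -scalemxAr -scalemxAl scalerA mulVf // scale1r trmx_inv.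
by rewrite mulmxA mulmxK ?unitmx_tr // mulKmx.
Qed.

(** * Invariants of scaled congruence *)

Section Invariants.

Variable F : fieldType.

Implicit Types A w : 'M[F]_3.

Lemma cofmx3 (a b c d e f g h i : F) : cofmx (mx3 a b c d e f g h i) =
  mx3 (e * i - f * h) (f * g - d * i) (d * h - e * g)
      (h * c - i * b) (i * a - g * c) (g * b - h * a)
      (b * f - c * e) (c * d - a * f) (a * e - b * d).
Proof. by rewrite /cofmx !mx3E. Qed.

(* [w + w^T] and [w - w^T] are twice the symmetric and alternating parts of [w]. *)
Definition vanishing w : seq bool :=
  [:: \det w == 0; cofmx w == 0; w == 0;
      \det (w + w^T) == 0; cofmx (w + w^T) == 0; w + w^T == 0; w - w^T == 0].

Variables (w w' A : 'M[F]_3) (l : F).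
Hypotheses (uA : A \in unitmx) (l0 : l != 0) (w'E : w' = l *: (A *m w *m A^T)).

Lemma congr_eq0 B k (v : 'M[F]_3) : B \in unitmx -> k != 0 ->
  (k *: (B *m v *m B^T) == 0) = (v == 0).
Proof.
move=> uB k0; rewrite scaler_eq0 (negbTE k0) /=.
apply/eqP/eqP=> [|->]; last by rewrite mulmx0 mul0mx.
move/(congr1 (mulmx^~ (invmx B^T))); rewrite mul0mx mulmxK ?unitmx_tr //.
by move/(congr1 (mulmx (invmx B))); rewrite mulmx0 mulKmx.
Qed.

Lemma congr_addT : w' + w'^T = l *: (A *m (w + w^T) *m A^T).
Proof.
rewrite w'E linearZ /= -scalerDr !trmx_mul trmxK.
by rewrite mulmxDr mulmxDl !mulmxA.
Qed.

Lemma congr_subT : w' - w'^T = l *: (A *m (w - w^T) *m A^T).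
Proof.
rewrite w'E linearZ /= -scalerBr !trmx_mul trmxK.
by rewrite mulmxBr mulmxBl !mulmxA.
Qed.

Lemma congr_det (v : 'M[F]_3) :
  \det (l *: (A *m v *m A^T)) = l ^+ 3 * \det A ^+ 2 * \det v.
Proof. by rewrite detZ !det_mulmx det_tr; ring. Qed.

Lemma congr_cofmx (v : 'M[F]_3) : cofmx (l *: (A *m v *m A^T)) =
  l ^+ 2 *: (cofmx A *m cofmx v *m (cofmx A)^T).
Proof. by rewrite cofmxZ !cofmxM cofmxT. Qed.

Lemma vanishing_congr : vanishing w' = vanishing w.
Proof.
rewrite /vanishing congr_addT congr_subT w'E !congr_det !congr_cofmx.
have k0 : l ^+ 3 * \det A ^+ 2 != 0.
  by rewrite mulf_neq0 ?expf_neq0 // -unitfE -unitmxE.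
rewrite !congr_eq0 ?cofmx_unit ?expf_neq0 //.
by rewrite ![_ * \det _ == 0]mulf_eq0 (negbTE k0).
Qed.

(** Both determinants are multiplied by the same factor [l ^+ 3 * \det A ^+ 2]; cross-multiplication
    states that their ratio is invariant without dividing. *)
Lemma det_ratio_congr :
  \det w' * \det (w + w^T) = \det w * \det (w' + w'^T).
Proof. by rewrite congr_addT w'E !congr_det; ring. Qed.

(** Both cofactor matrices undergo the same linear transformation, so a linear relation between them
    persists. It replaces the ratio of determinants when these vanish. *)
Lemma cofmx_prop_congr a b : a *: cofmx (w + w^T) = b *: cofmx w ->
  a *: cofmx (w' + w'^T) = b *: cofmx w'.
Proof.
move=> E; rewrite congr_addT w'E !congr_cofmx !scalerA !(mulrC _ (l ^+ 2)).
rewrite -!scalerA; congr (_ *: _).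
by rewrite ![_ *: (_ *m _^T)]scalemxAl ![_ *: (cofmx A *m _)]scalemxAr E.
Qed.

(** When each cofactor matrix has only its last diagonal entry, these entries differ by the square
    of [l] times the last diagonal entry of [cofmx A]. *)
Lemma cofmx_disc_congr x y :
  cofmx (w + w^T) = mx3 0 0 0 0 0 0 0 0 x ->
  cofmx (w' + w'^T) = mx3 0 0 0 0 0 0 0 0 y -> exists u, y = x * u ^+ 2.
Proof.
rewrite congr_addT congr_cofmx => -> /matrixP/(_ (inord 2) (inord 2)).
rewrite mx3E (mx3_eta (cofmx A)) mx3T !mx3M mx3Z mx3E => <-.
by exists (l * cofmx A (inord 2) (inord 2)); ring.
Qed.

End Invariants.

(** * Values of the invariants on the normal forms *)

Section VanishingValues.

Variable F : fieldType.
Hypothesis two_neq0 : 2 != 0 :> F.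

Let double_eq0 (x : F) : (x + x == 0) = (x == 0).
Proof. by rewrite -mulr2n -mulr_natl mulf_eq0 (negbTE two_neq0). Qed.

Let simp := (@mulr0 F, @mul0r F, @mulr1 F, @mul1r F, @subr0 F, @sub0r F, @addr0 F,
  @add0r F, @mulrN F, @mulNr F, @opprK F, @oppr0 F, @subrr F, @addNr F, @eqxx F, @oppr_eq0 F).

Lemma vanishing_block (a x c y : F) :
  vanishing (mx3 a 0 0 0 x c 0 (- c) y) =
  [:: (a == 0) || (x * y + c * c == 0);
      [&& x * y + c * c == 0, (a == 0) || (y == 0), (a == 0) || (c == 0)
        & (a == 0) || (x == 0)];
      [&& a == 0, x == 0, c == 0 & y == 0];
      [|| a == 0, x == 0 | y == 0];
      [&& (x == 0) || (y == 0), (a == 0) || (y == 0) & (a == 0) || (x == 0)];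
      [&& a == 0, x == 0 & y == 0]; c == 0].
Proof.
rewrite /vanishing mx3T mx3N !mx3D !cofmx3 !mx3_det !mx3_eq0 !simp.
rewrite -?opprD ?(oppr_eq0, double_eq0, mulf_eq0, andbT).
by case: (a == 0); case: (x == 0); case: (c == 0); case: (y == 0); case: (_ == 0).
Qed.

Lemma vanishing_diag (a x y : F) : vanishing (mx3 a 0 0 0 x 0 0 0 y) =
  let v1 := [&& a == 0, x == 0 & y == 0] in
  let v2 := [&& (x == 0) || (y == 0), (a == 0) || (y == 0) & (a == 0) || (x == 0)] in
  let v3 := [|| a == 0, x == 0 | y == 0] in
  [:: v3; v2; v1; v3; v2; v1; true].
Proof.
have := vanishing_block a x 0 y; rewrite oppr0 mulr0 addr0 => ->.
by rewrite eqxx !orbT !mulf_eq0.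
Qed.

Lemma vanishing_corner (a : F) : vanishing (mx3 a 0 0 0 0 1 0 0 0) =
  [:: true; a == 0; false; a == 0; false; false; false].
Proof.
rewrite /vanishing mx3T mx3N !mx3D !cofmx3 !mx3_det !mx3_eq0 !simp.
by rewrite ?(oppr_eq0, double_eq0, mulf_eq0, andbT, oner_eq0, andbF).
Qed.

Lemma vanishing_J5 : vanishing (mx3 0 0 1 0 1 1 1 (- 1) 0 : 'M[F]_3) = nseq 7 false.
Proof.
rewrite /vanishing mx3T mx3N !mx3D !cofmx3 !mx3_det !mx3_eq0 !simp.
by rewrite ?(oppr_eq0, double_eq0, mulf_eq0, andbT, oner_eq0, andbF).
Qed.

Lemma vanishing_K3 : vanishing (mx3 0 0 1 0 0 0 0 1 0 : 'M[F]_3) =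
  [:: true; false; false; true; false; false; false].
Proof.
rewrite /vanishing mx3T mx3N !mx3D !cofmx3 !mx3_det !mx3_eq0 !simp.
by rewrite ?(oppr_eq0, double_eq0, mulf_eq0, andbT, oner_eq0, andbF).
Qed.

Lemma block_det (a x c y : F) (w := mx3 a 0 0 0 x c 0 (- c) y) :
  (\det w = a * (x * y + c ^+ 2)) * (\det (w + w^T) = 8 * a * x * y).
Proof. by split; rewrite /w ?mx3T ?mx3D mx3_det; ring. Qed.

Lemma block_cofmx (a x c y : F) (w := mx3 a 0 0 0 x c 0 (- c) y) :
  (cofmx w = mx3 (x * y + c ^+ 2) 0 0 0 (a * y) (a * c) 0 (- (a * c)) (a * x)) *
  (cofmx (w + w^T) = mx3 (4 * x * y) 0 0 0 (4 * a * y) 0 0 0 (4 * a * x)).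
Proof. by split; rewrite /w ?mx3T ?mx3D cofmx3; congr mx3; ring. Qed.

Lemma J5_det (w := mx3 0 0 1 0 1 1 1 (- 1) 0 : 'M[F]_3) :
  (\det w = - 1) * (\det (w + w^T) = - 8).
Proof. by split; rewrite /w ?mx3T ?mx3D mx3_det; ring. Qed.

Lemma K3_cofmx (w := mx3 0 0 1 0 0 0 0 1 0 : 'M[F]_3) :
  (cofmx w = mx3 0 0 0 1 0 0 0 0 0) *
  (cofmx (w + w^T) = mx3 (- 1) 1 0 1 (- 1) 0 0 0 0).
Proof. by split; rewrite /w ?mx3T ?mx3D cofmx3; congr mx3; ring. Qed.

Let four_neq0 : 4 != 0 :> F. Proof. by rewrite (natrM _ 2 2) mulf_neq0. Qed.

Let eight_neq0 : 8 != 0 :> F. Proof. by rewrite (natrM _ 2 4) mulf_neq0. Qed.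

(** The symmetrised form has cofactor matrix with the single entry [4 * x], its discriminant on the
    first two coordinates. The case [c = 1] serves [J3] and the case [c = 0] serves [K1]. *)
Lemma scaled_congr_square_class (x y c : F) :
  scaled_congr (mx3 1 0 0 0 x c 0 (- c) 0) (mx3 1 0 0 0 y c 0 (- c) 0) ->
  exists u, y = x * u ^+ 2.
Proof.
move=> [A [l [uA l0 E]]]; have := cofmx_disc_congr (x := 4 * x) (y := 4 * y) E.
rewrite !block_cofmx !mulr0 !mulr1 => /(_ erefl erefl)[u uE].
by exists u; apply: (mulfI four_neq0); rewrite uE -mulrA.
Qed.

(** The two determinants are [r + 1] and [8 * r], and [r / (r + 1)] determines [r]. *)
Lemma scaled_congr_J4_inj (r q : F) :
  scaled_congr (mx3 1 0 0 0 1 1 0 (- 1) r) (mx3 1 0 0 0 1 1 0 (- 1) q) -> r = q.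
Proof.
move=> [A [l [uA l0 E]]]; have := det_ratio_congr E; rewrite !block_det => {}E.
apply: (mulfI eight_neq0).
have -> : 8 * r = (1 * (1 * q + 1 ^+ 2)) * (8 * 1 * 1 * r) - q * (8 * r) by ring.
by rewrite E; ring.
Qed.

(** For [J5] the ratio of the determinants is 8, and [8 * r = 8 * (r + 1)] is impossible. *)
Lemma scaled_congr_J4_J5 (r : F) :
  ~ scaled_congr (mx3 1 0 0 0 1 1 0 (- 1) r) (mx3 0 0 1 0 1 1 1 (- 1) 0).
Proof.
move=> [A [l [uA l0 E]]]; have := det_ratio_congr E.
rewrite !block_det !J5_det => {}E; move: eight_neq0.
have -> : 8 = - 1 * (8 * 1 * 1 * r) - 1 * (1 * r + 1 ^+ 2) * - 8 by ring.
by rewrite E subrr eqxx.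
Qed.

(** Both cofactor matrices live in the first diagonal entry, with values [r + 1] and [4 * r]. *)
Lemma K6_cofmx_prop (r : F) (w := mx3 0 0 0 0 1 1 0 (- 1) r) :
  (r + 1) *: cofmx (w + w^T) = (4 * r) *: cofmx w.
Proof. by rewrite /w !block_cofmx !mx3Z; congr mx3; ring. Qed.

Lemma scaled_congr_K6_inj (r q : F) :
  scaled_congr (mx3 0 0 0 0 1 1 0 (- 1) r) (mx3 0 0 0 0 1 1 0 (- 1) q) -> r = q.
Proof.
move=> [A [l [uA l0 E]]]; have := cofmx_prop_congr E (K6_cofmx_prop r).
rewrite !block_cofmx !mx3Z => /matrixP/(_ (inord 0) (inord 0)).
rewrite !mx3E => {}E; apply: (mulfI four_neq0).
have -> : 4 * r = 4 * r * (1 * q + 1 ^+ 2) - 4 * r * q by ring.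
by rewrite -E; ring.
Qed.

(** For [K3] the two cofactor matrices are not proportional: in the first diagonal entry one has 0
    and the other [-1]. *)
Lemma scaled_congr_K6_K3 (r : F) : r + 1 != 0 ->
  ~ scaled_congr (mx3 0 0 0 0 1 1 0 (- 1) r) (mx3 0 0 1 0 0 0 0 1 0).
Proof.
move=> r1 [A [l [uA l0 E]]]; have := cofmx_prop_congr E (K6_cofmx_prop r).
rewrite !K3_cofmx !mx3Z => /matrixP/(_ (inord 0) (inord 0)); rewrite !mx3E.
by rewrite mulrN1 mulr0 => /eqP; rewrite oppr_eq0 (negbTE r1).
Qed.

End VanishingValues.

(** * Classification of the forms over the prime field *)

Section Types.

Variable p : nat.
Hypotheses (p_prime : prime p) (p_odd : odd p).
Variable eta : 'F_p.
Hypothesis nonsquare : forall u : 'F_p, u ^+ 2 <> eta.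

Local Notation F := 'F_p.

Definition type_mx3 (t : matrix_type p) : 'M[F]_3 :=
  match t with
  | J1 => mx3 1 0 0 0 1 0 0 0 1
  | J2 => mx3 1 0 0 0 0 1 0 (- 1) 0
  | J3 nu => mx3 1 0 0 0 nu 1 0 (- 1) 0
  | J4 r => mx3 1 0 0 0 1 1 0 (- 1) r%:R
  | J5 => mx3 0 0 1 0 1 1 1 (- 1) 0
  | K1 nu => mx3 1 0 0 0 nu 0 0 0 0
  | K2 => mx3 1 0 0 0 0 1 0 0 0
  | K3 => mx3 0 0 1 0 0 0 0 1 0
  | K4 => mx3 0 0 0 0 0 1 0 (- 1) 0
  | K5 => mx3 0 0 0 0 1 1 0 (- 1) 0
  | K6 r => mx3 0 0 0 0 1 1 0 (- 1) r%:R
  | L1 => mx3 0 0 0 0 0 0 0 0 0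
  | L2 => mx3 1 0 0 0 0 0 0 0 0
  | L3 => mx3 0 0 0 0 0 1 0 0 0
  end.

Lemma type_matrixE t : type_matrix t = type_mx3 t.
Proof.
case: t => [||nu|r||nu|||||r|||] /=; rewrite -?mx3_0 //;
  apply/matrixP; do 2!elim/ord3P;
  rewrite !mxE -!val_eqE /= !inordK //=;
  by rewrite ?(addr0, add0r, oppr0, mulr0, mulr1, subr0).
Qed.

Lemma natr_Fp_eq0 n : (n%:R == 0 :> F) = (p %| n)%N.
Proof. by rewrite -val_eqE /= val_Fp_nat. Qed.

Lemma two_Fp_neq0 : 2 != 0 :> F.
Proof.
rewrite natr_Fp_eq0 gtnNdvd // ltn_neqAle prime_gt1 // andbT.
by apply: contraTneq p_odd => <-.
Qed.

(** Turns the parameter of a reduced block into the integer [r] of [J4] or [K6]; the value [-1] goes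
    to [K2] or [L3]. *)
Lemma Fp_residue (y : F) : y != 0 -> y != - 1 ->
  exists2 r, (1 <= r <= p - 2)%N & y = r%:R.
Proof.
move=> y0 y1; exists (y : nat); last by rewrite natr_Zp.
have yp : (y < p)%N by rewrite -[X in (_ < X)%N](Fp_cast p_prime) ltn_ord.
have py : (y.+1 != p)%N.
  apply: contra y1 => /eqP E; rewrite -addr_eq0 -[y in y + 1]natr_Zp natr1 E.
  by rewrite natr_Fp_eq0.
rewrite lt0n -[y != 0 :> nat]/(y != 0) y0 leq_subRL ?prime_gt1 // add2n.
by rewrite ltn_neqAle py yp.
Qed.

Lemma scaled_congr_type w : exists2 t : matrix_type p,
  valid_type eta t & scaled_congr w (type_matrix t).
Proof.
suff [t vt E] : exists2 t : matrix_type p, valid_type eta t & scaled_congr w (type_mx3 t).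
  by exists t; rewrite ?type_matrixE.
have two0 := two_Fp_neq0.
have sqc d : exists u : F, d = u ^+ 2 \/ d = eta * u ^+ 2.
  exact: finField_nonsquare.
have two_sq := Fp_two_squares_nonsquare p_prime nonsquare.
have bnf := scaled_congr_block_nf two0 nonsquare sqc two_sq.
have [a [b [c [q [r [s [t [nz E]]]]]]]] := scaled_congr_radical two0 w.
(* If [a] is nonzero the first vector splits off with value 1. The six cases are [c = 0] and then
   [c = 1], each with the three shapes of the diagonal [(x, y)]. *)
have [a0|a0] := eqVneq a 0; last first.
  have [q1 [r1 [s1 [t1 /(scaled_congr_trans E){}E]]]] := scaled_congr_split b c q r s t a0.
  have [x [k [y [kP xyP /(scaled_congr_trans E){}E]]]] := bnf 1 q1 r1 s1 t1.
  case: kP E => ->; rewrite ?oppr0; case: xyP => -[].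
  - by move=> -> -> E; exists L2.
  - by move=> nuP -> E; exists (K1 x).
  - by move=> -> y0 E; exists J1 => //; apply: scaled_congr_trans E _;
      apply: (scaled_congr_J1 nonsquare).
  - by move=> -> -> E; exists J2.
  - by move=> nuP -> E; exists (J3 x).
  - move=> -> y0; have [->|y1] := eqVneq y (- 1) => E.
      by exists K2 => //; apply: scaled_congr_trans E (scaled_congr_isotropic _ _).
    by have [z zP yE] := Fp_residue y0 y1; exists (J4 z); rewrite //= -yE.
(* For [a = 0] the first vector either splits off with value 0, or is isotropic without being in the
   radical of [w + w^T]. *)
have [bc|bc] : (b = 0 /\ c = 0) \/ (b != 0 \/ c != 0).
  by have [->|] := eqVneq b 0; have [->|] := eqVneq c 0; auto.
  move: E; rewrite a0; case: bc => -> -> E {nz}.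
  have [x [k [y [kP xyP /(scaled_congr_trans E){}E]]]] := bnf 0 q r s t.
  case: kP E => ->; rewrite ?oppr0; case: xyP => -[].
  - by move=> -> -> E; exists L1.
  - move=> nuP -> E; exists L2 => //; apply: scaled_congr_trans E (scaled_congr_L2 _).
    by case: nuP => ->; rewrite ?oner_eq0 ?(nonsquare_neq0 nonsquare).
  - move=> -> y0 E.
    have [nu nuP E'] := scaled_congr_K1 sqc y0.
    by exists (K1 nu) => //; apply: scaled_congr_trans E E'.
  - by move=> -> -> E; exists K4.
  - move=> nuP -> E; exists K5 => //; apply: scaled_congr_trans E (scaled_congr_K5 _).
    by case: nuP => ->; rewrite ?oner_eq0 ?(nonsquare_neq0 nonsquare).
  - move=> -> y0; have [->|y1] := eqVneq y (- 1) => E.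
      by exists L3 => //; apply: scaled_congr_trans E (scaled_congr_isotropic _ _).
    by have [z zP yE] := Fp_residue y0 y1; exists (K6 z); rewrite //= -yE.
have rs : r <> s.
  case: nz => // /eqP; rewrite mx3_eq0 => /and5P[_ b0 c0 _ _].
  by case: bc; rewrite ?b0 ?c0.
have [d [k [k0]]] := scaled_congr_hyperbolic two0 q t rs bc.
rewrite -a0 => /(scaled_congr_trans E) {}E.
have [d0|d0] := eqVneq d 0.
  exists K3 => //; apply: scaled_congr_trans E _; rewrite d0 a0.
  exact: scaled_congr_K3.
exists J5 => //; apply: scaled_congr_trans E _; rewrite a0.
exact: scaled_congr_J5.
Qed.

(** The rows coincide only for [J4] with [J5], for [K3] with [K6], and for different parameters of
    one type. *)
Definition type_vanishing (t : matrix_type p) : seq bool :=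
  match t with
  | J1 => [:: false; false; false; false; false; false; true]
  | J2 => [:: false; false; false; true; true; false; false]
  | J3 _ => [:: false; false; false; true; false; false; false]
  | J4 _ | J5 => [:: false; false; false; false; false; false; false]
  | K1 _ => [:: true; false; false; true; false; false; true]
  | K2 => [:: true; false; false; false; false; false; false]
  | K3 | K6 _ => [:: true; false; false; true; false; false; false]
  | K4 => [:: true; false; false; true; true; true; false]
  | K5 => [:: true; false; false; true; true; false; false]
  | L1 => [:: true; true; true; true; true; true; true]
  | L2 => [:: true; true; false; true; true; false; true]
  | L3 => [:: true; true; false; true; false; false; false]
  end.

Lemma valid_nu_neq0 (nu : F) : nu = 1 \/ nu = eta -> nu != 0.
Proof. by case=> ->; rewrite ?oner_eq0 ?(nonsquare_neq0 nonsquare). Qed.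

Lemma valid_r_ltn r : (1 <= r <= p - 2)%N -> (r < p)%N.
Proof.
by case/andP=> _ /leq_ltn_trans; apply; rewrite ltn_subrL /= prime_gt0.
Qed.

Lemma valid_r_neq0 r : (1 <= r <= p - 2)%N -> r%:R != 0 :> F.
Proof.
move=> rP; rewrite natr_Fp_eq0 // gtnNdvd ?valid_r_ltn //.
by case/andP: rP.
Qed.

Lemma valid_r1_neq0 r : (1 <= r <= p - 2)%N -> 1 + r%:R != 0 :> F.
Proof.
case/andP=> r0; rewrite leq_subRL ?prime_gt1 // add2n => rp.
by rewrite nat1r natr_Fp_eq0 // gtnNdvd.
Qed.

Lemma valid_r_inj r s : (1 <= r <= p - 2)%N -> (1 <= s <= p - 2)%N ->
  r%:R = s%:R :> F -> r = s.
Proof.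
by move=> /valid_r_ltn rp /valid_r_ltn sp /(congr1 val) /=; rewrite !val_Fp_nat // !modn_small.
Qed.

Lemma vanishing_type t : valid_type eta t ->
  vanishing (type_matrix t) = type_vanishing t.
Proof.
have two0 := two_Fp_neq0.
rewrite type_matrixE.
have blk a x c y := vanishing_block two0 a x c y.
have blk0 a x y := vanishing_diag two0 a x y.
have one0 : (1 == 0 :> F) = false := oner_eq0 _.
have simp := (@mulr0 F, @mul0r F, @mulr1 F, @mul1r F, @addr0 F, @add0r F, @eqxx F, one0).
case: t => [||nu|r||nu|||||r|||] /= vt.
- by rewrite blk0 !simp.
- by rewrite blk !simp.
- by rewrite blk !simp (negbTE (valid_nu_neq0 vt)).
- rewrite blk !simp (negbTE (valid_r_neq0 vt)).
  by rewrite addrC (negbTE (valid_r1_neq0 vt)).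
- by rewrite vanishing_J5.
- by rewrite blk0 !simp (negbTE (valid_nu_neq0 vt)).
- by rewrite vanishing_corner // !simp.
- by rewrite vanishing_K3.
- by rewrite blk !simp.
- by rewrite blk !simp.
- rewrite blk !simp (negbTE (valid_r_neq0 vt)).
  by rewrite addrC (negbTE (valid_r1_neq0 vt)).
- by rewrite blk0 !simp.
- by rewrite blk0 !simp.
- by rewrite vanishing_corner // !simp.
Qed.

Lemma valid_nu_square_class (mu nu : F) : mu = 1 \/ mu = eta -> nu = 1 \/ nu = eta ->
  (exists u, nu = mu * u ^+ 2) -> mu = nu.
Proof.
case=> ->; case=> -> // [u uE]; first by case: (nonsquare (u := u)); rewrite uE mul1r.
have u0 : u != 0.
  by apply: contra_eqT (oner_neq0 F) => /negPn/eqP u0; rewrite uE u0 expr0n mulr0 eqxx.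
by case: (nonsquare (u := u^-1)); rewrite -[LHS]mulr1 uE; field.
Qed.

Lemma scaled_congr_type_inj s t : valid_type eta s -> valid_type eta t ->
  scaled_congr (type_matrix s) (type_matrix t) -> s = t.
Proof.
move=> vs vt st; have ts := scaled_congr_sym st; have [A [l [uA l0 E]]] := st.
have := vanishing_congr uA l0 E; rewrite !vanishing_type // => V.
have two0 := two_Fp_neq0.
rewrite !type_matrixE {A l uA l0 E} in st ts.
(* Pairs with different vanishing patterns contradict [V]; those that remain need the finer
   invariants. *)
case: s vs st ts V => [||mu|r||mu|||||r|||];
  case: t vt => [||nu|q||nu|||||q|||] //= vt vs st ts _.
- congr J3; apply: valid_nu_square_class vs vt _.
  exact: scaled_congr_square_class st.
- congr J4; apply: valid_r_inj vs vt _; exact: scaled_congr_J4_inj st.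
- by case: (scaled_congr_J4_J5 two0 st).
- by case: (scaled_congr_J4_J5 two0 ts).
- congr K1; apply: valid_nu_square_class vs vt _.
  by apply: (scaled_congr_square_class two0 (c := 0)); rewrite oppr0.
- by case: (scaled_congr_K6_K3 _ ts); rewrite // addrC valid_r1_neq0.
- by case: (scaled_congr_K6_K3 _ st); rewrite // addrC valid_r1_neq0.
- congr K6; apply: valid_r_inj vs vt _; exact: scaled_congr_K6_inj st.
Qed.
End Types.

(** * Words in class-two groups *)

Local Close Scope ring_scope.
Local Open Scope group_scope.

Section Words.

Variable p : nat.
Hypothesis p_prime : prime p.

Local Notation rV := 'rV['F_p]_3.

(** Coordinates enter as exponents through their least representatives. On elements of exponent [p]
    this is linear in [v]; on generators of [G] it only selects a representative modulo
    ['Phi(G)]. *)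
Definition word (gT : finGroupType) (x y z : gT) (v : rV) : gT :=
  x ^+ v 0%R (inord 0) * y ^+ v 0%R (inord 1) * z ^+ v 0%R (inord 2).

Lemma expgFpD (gT : finGroupType) (x : gT) (a b : 'F_p) :
  x ^+ p = 1 -> x ^+ (a + b)%R = x ^+ a * x ^+ b.
Proof.
by move=> xp; rewrite -expgD -(expg_mod (a + b) xp) /=; congr (x ^+ (_ %% _)); apply: Fp_cast.
Qed.

Lemma expgFpM (gT : finGroupType) (x : gT) (a b : 'F_p) :
  x ^+ p = 1 -> x ^+ (a * b)%R = x ^+ a ^+ b.
Proof.
by move=> xp; rewrite -expgM -(expg_mod (a * b) xp) /=; congr (x ^+ (_ %% _)); apply: Fp_cast.
Qed.

Lemma word_delta (gT : finGroupType) (x y z : gT) :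
  (word x y z (delta_mx 0%R (inord 0)) = x) *
  (word x y z (delta_mx 0%R (inord 1)) = y) *
  (word x y z (delta_mx 0%R (inord 2)) = z).
Proof.
have one_mod : (1 %% (Zp_trunc (pdiv p)).+2 = 1)%N.
  by rewrite Fp_cast // modn_small ?prime_gt1.
by rewrite /word !mxE -!val_eqE /= !inordK //= one_mod !expg0 !expg1 ?mul1g ?mulg1.
Qed.

Lemma word_morph (gT hT : finGroupType) (D : {group gT}) (f : {morphism D >-> hT}) x y z v :
  x \in D -> y \in D -> z \in D -> f (word x y z v) = word (f x) (f y) (f z) v.
Proof. by move=> Dx Dy Dz; rewrite !morphM ?morphX ?groupM ?groupX. Qed.

Lemma word_in (gT : finGroupType) (H : {group gT}) x y z v :
  x \in H -> y \in H -> z \in H -> word x y z v \in H.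
Proof. by move=> Hx Hy Hz; rewrite !groupM ?groupX. Qed.

Section Abelem.

Variables (gT : finGroupType) (H : {group gT}).
Hypothesis abelH : p.-abelem H.

Let expHp x : x \in H -> x ^+ p = 1.
Proof. by case/(abelemP p_prime): abelH => _; apply. Qed.

Let commH x y : x \in H -> y \in H -> commute x y.
Proof. by move=> Hx Hy; have [/centsP cHH _] := abelemP p_prime abelH; apply: cHH. Qed.

Lemma wordD x y z u v : x \in H -> y \in H -> z \in H ->
  word x y z (u + v)%R = word x y z u * word x y z v.
Proof.
move=> Hx Hy Hz; rewrite /word !mxE !expgFpD ?expHp // !mulgA.
set a := x ^+ _; set a' := x ^+ _; set b := y ^+ _; set b' := y ^+ _.
set c := z ^+ _; set c' := z ^+ _.
have cab : commute b a' by apply: commH; rewrite groupX.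
have cca : commute c a' by apply: commH; rewrite groupX.
have ccb : commute c b' by apply: commH; rewrite groupX.
by rewrite -!mulgA (mulgA c) cca -(mulgA a') (mulgA c) ccb !mulgA -(mulgA a b) cab !mulgA.
Qed.

Lemma wordZ x y z (c : 'F_p) v : x \in H -> y \in H -> z \in H ->
  word x y z (c *: v)%R = word x y z v ^+ c.
Proof.
move=> Hx Hy Hz; rewrite /word !mxE ![(c * _)%R]mulrC !expgFpM ?expHp //.
rewrite !expgMn //; apply: commH; rewrite ?groupM ?groupX //.
Qed.

Lemma word0 (x y z : gT) : word x y z 0%R = 1.
Proof. by rewrite /word !mxE !expg0 !mulg1. Qed.

Lemma word_lin x y z (r0 r1 r2 v : rV) : x \in H -> y \in H -> z \in H ->
  word (word x y z r0) (word x y z r1) (word x y z r2) v =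
  word x y z (v 0 (inord 0) *: r0 + v 0 (inord 1) *: r1 + v 0 (inord 2) *: r2)%R.
Proof. by move=> Hx Hy Hz; rewrite !wordD // !wordZ. Qed.

Lemma word_comp x y z (C : 'M['F_p]_3) v : x \in H -> y \in H -> z \in H ->
  word (word x y z (row (inord 0) C)) (word x y z (row (inord 1) C))
       (word x y z (row (inord 2) C)) v = word x y z (v *m C)%R.
Proof. by move=> Hx Hy Hz; rewrite mulmx_sum_row big_ord3 word_lin. Qed.

Lemma word_surj x y z h : <<[set x; y; z]>> = H -> h \in H -> exists v, h = word x y z v.
Proof.
move=> defH; have [Hx Hy Hz] : [/\ x \in H, y \in H & z \in H].
  by rewrite -defH; split; rewrite mem_gen // !inE eqxx ?orbT.
pose W := [set word x y z v | v : rV].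
have gW : group_set W.
  apply/group_setP; split; first by apply/imsetP; exists 0%R; rewrite ?word0.
  move=> _ _ /imsetP[u _ ->] /imsetP[v _ ->].
  by apply/imsetP; exists (u + v)%R; rewrite ?wordD.
have sHW : H \subset Group gW.
  rewrite -defH gen_subG; apply/subsetP=> a; rewrite !inE => aP.
  have [w0 w1] := word_delta x y z; case: w0 => w0 w0'.
  by case/orP: aP => [/orP[]|] /eqP->; apply/imsetP;
    [exists (delta_mx 0%R (inord 0))%R | exists (delta_mx 0%R (inord 1))%R
    | exists (delta_mx 0%R (inord 2))%R].
by move=> Hh; have /imsetP[v _ ->] := subsetP sHW _ Hh; exists v.
Qed.

End Abelem.

Lemma quotient_gen3 (gT : finGroupType) (G H : {group gT}) a1 a2 a3 :
  H <| G -> <<[set a1; a2; a3]>> = G ->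
  <<[set coset H a1; coset H a2; coset H a3]>> = G / H.
Proof.
move=> /normal_norm nHG genA.
have sA : [set a1; a2; a3] \subset 'N(H).
  by apply: subset_trans nHG; rewrite -genA subset_gen.
transitivity (<<[set a1; a2; a3]>> / H); last by rewrite genA.
rewrite quotient_gen //; congr <<_>>; move: sA; rewrite !subUset !sub1set.
by case/andP=> /andP[N1 N2] N3; rewrite /quotient !morphimU !morphim_set1.
Qed.

(** Elements of ['Phi(G)] are non-generators, so generation may be tested modulo [H]. It is used
    both for the derived and for the Frattini subgroup. *)
Lemma gen_quotient_Phi (gT : finGroupType) (G H : {group gT}) a1 a2 a3 :
  H <| G -> H \subset 'Phi(G) -> a1 \in G -> a2 \in G -> a3 \in G ->
  <<[set coset H a1; coset H a2; coset H a3]>> = G / H -> <<[set a1; a2; a3]>> = G.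
Proof.
move=> nsHG sHPhi Ga1 Ga2 Ga3 genQ; have nHG := normal_norm nsHG.
have sAG : [set a1; a2; a3] \subset G by rewrite !subUset !sub1set Ga1 Ga2.
apply: Phi_nongen; apply/eqP; rewrite eqEsubset join_subG Phi_sub sAG /=.
have sGHA : G \subset H * <<[set a1; a2; a3]>>.
  have nHA := subset_trans sAG nHG.
  rewrite -quotientSK // quotient_gen //= -genQ genS //.
  by rewrite !subUset !sub1set !mem_morphim ?(subsetP nHG) // !inE eqxx ?orbT.
apply: subset_trans sGHA _.
by rewrite mul_subG ?(subset_trans sHPhi) ?joing_subl // gen_subG joing_subr.
Qed.

End Words.

(** * Homocyclic abelian groups of rank three *)

Lemma joing_cycle3 (gT : finGroupType) (x y z : gT) :
  <[x]> <*> <[y]> <*> <[z]> = <<[set x; y; z]>>.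
Proof.
apply/eqP; rewrite eqEsubset; apply/andP; split.
  by rewrite !join_subG !cycle_subG !mem_gen // !inE eqxx ?orbT.
rewrite gen_subG !subUset !sub1set [z \in _]mem_gen ?inE ?cycle_id ?orbT // andbT.
by apply/andP; split; apply: (subsetP (joing_subl _ _));
  rewrite mem_gen // inE cycle_id ?orbT.
Qed.

Lemma muln_eq_max (a b c d : nat) : 0 < c -> 0 < d -> a <= c -> b <= d ->
  c * d <= a * b -> a = c /\ b = d.
Proof.
move=> c0 d0 ac bd cdab.
have bE : b = d.
  apply/eqP; rewrite eqn_leq bd -(leq_pmul2l c0) (leq_trans cdab) //.
  by rewrite leq_mul2r ac orbT.
by split=> //; apply/eqP; rewrite eqn_leq ac -(leq_pmul2r d0) -[in X in _ <= X]bE.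
Qed.

(** A counting argument: three cyclic subgroups of order at most [n] whose product has order [n ^ 3]
    must each have order [n] and intersect trivially. *)
Lemma homocyclic3_dprod (gT : finGroupType) (Q : {group gT}) (n : nat) c1 c2 c3 :
  abelian Q -> #|Q| = (n * n * n)%N -> (forall c, c \in Q -> c ^+ n = 1) ->
  <<[set c1; c2; c3]>> = Q ->
  [/\ <[c1]> \x <[c2]> \x <[c3]> = Q, #[c1] = n, #[c2] = n & #[c3] = n].
Proof.
move=> cQQ cardQ expQ genQ.
have [Q1 Q2 Q3] : [/\ c1 \in Q, c2 \in Q & c3 \in Q].
  by rewrite -genQ; split; rewrite mem_gen // !inE eqxx ?orbT.
have n0 : 0 < n by have := cardG_gt0 Q; rewrite cardQ !muln_gt0 => /andP[].
have le_n c : c \in Q -> #|<[c]>| <= n.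
  by move=> Qc; rewrite -orderE dvdn_leq // order_dvdn expQ.
have cent c d : c \in Q -> d \in Q -> <[d]> \subset 'C(<[c]>).
  by move=> Qc Qd; rewrite (sub_abelian_cent2 cQQ) // cycle_subG.
have C12 : <[c1]> <*> <[c2]> = <[c1]> * <[c2]> by rewrite cent_joinEr ?cent.
have s12 : <[c1]> <*> <[c2]> \subset Q by rewrite join_subG !cycle_subG Q1 Q2.
have C123 : (<[c1]> <*> <[c2]>) * <[c3]> = Q.
  rewrite -cent_joinEr; last by rewrite (sub_abelian_cent2 cQQ) // cycle_subG.
  by rewrite joing_cycle3.
have le12 : #|<[c1]> <*> <[c2]>| <= n * n.
  apply: leq_trans (_ : #|<[c1]>| * #|<[c2]>| <= _); last by rewrite leq_mul ?le_n.
  by rewrite C12 dvdn_leq ?dvdn_cardMg ?muln_gt0 ?cardG_gt0.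
have ti3 : (<[c1]> <*> <[c2]>) :&: <[c3]> = 1.
  by apply: cardMg_TI; rewrite C123 cardQ leq_mul ?le_n.
have := TI_cardMg ti3; rewrite C123 cardQ => card3.
have nn0 : 0 < n * n by rewrite muln_gt0 n0.
have [] := muln_eq_max nn0 n0 le12 (le_n _ Q3); first by rewrite -card3.
move=> e12 e3.
have ti12 : <[c1]> :&: <[c2]> = 1.
  by apply: cardMg_TI; rewrite -C12 e12 leq_mul ?le_n.
have := TI_cardMg ti12; rewrite -C12 e12 => card12.
have [] := muln_eq_max n0 n0 (le_n _ Q1) (le_n _ Q2); first by rewrite -card12.
move=> e1 e2; split=> //.
by rewrite (dprodEY _ ti12) ?cent // dprodE ?(sub_abelian_cent2 cQQ) // cycle_subG.
Qed.

(** * The abelianization and generating triples *)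

Section Standing.

Variables (p m : nat) (gT : finGroupType) (G : {group gT}).
Hypotheses (p_prime : prime p) (p_odd : odd p).
Hypothesis standG : standing_group p m m m G.

Local Notation n := (p ^ m)%N.
Local Notation Q := (G / G^`(1)).

Let pG : p.-group G := sg_pgroup standG.

Lemma der_sub_Phi : G^`(1) \subset 'Phi(G).
Proof. by rewrite (Phi_joing pG) joing_subl. Qed.

Lemma der_sub_center : G^`(1) \subset 'Z(G).
Proof. exact: subset_trans der_sub_Phi (sg_Phi standG). Qed.

Lemma standing_basis : exists b1 b2 b3,
  [/\ <[b1]> \x (<[b2]> \x <[b3]>) = Q, #[b1] = n, #[b2] = n & #[b3] = n].
Proof.
have [b] := abelian_structure (der_abelian 0 G : abelian Q).
rewrite (sg_type standG); case: b => [|b1 [|b2 [|b3 [|]]]] //.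
rewrite !big_cons big_nil dprodg1 => dQ [o1 o2 o3].
by exists b1, b2, b3.
Qed.

Lemma card_abelianization : #|Q| = (n * n * n)%N.
Proof.
have [b1 [b2 [b3 [dQ o1 o2 o3]]]] := standing_basis.
rewrite -(dprod_card dQ); have [[_ H _ defH] _ _ _] := dprodP dQ.
by rewrite defH -(dprod_card defH) -!orderE o1 o2 o3 mulnA.
Qed.

Lemma exponent_abelianization c : c \in Q -> c ^+ n = 1.
Proof.
have [b1 [b2 [b3 [dQ o1 o2 o3]]]] := standing_basis.
have expC b d : #[b] = n -> d \in <[b]> -> d ^+ n = 1.
  by move=> ob /cycleP[i ->]; rewrite -expgM mulnC expgM -ob expg_order expg1n.
have abQ : abelian Q := der_abelian 0 G.
have [[_ H _ defH] <- c1H _] := dprodP dQ.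
rewrite defH => /mulsgP[d h b1d Hh ->].
rewrite expgMn; last by apply/commute_sym/(centsP c1H); rewrite ?defH.
rewrite (expC _ b1) // mul1g; case/dprodP: defH Hh => _ <- c23 _ /mulsgP[d2 d3 b2d b3d ->].
have cd : commute d2 d3 by apply/commute_sym/(centsP c23).
by rewrite expgMn // (expC _ b2) // (expC _ b3) // mulg1.
Qed.

Lemma expg_in_der g : g \in G -> g ^+ n \in G^`(1).
Proof.
move=> Gg; have Ng := subsetP (der_norm 1 G) _ Gg.
apply: coset_idr; rewrite ?groupX // morphX //.
by apply: exponent_abelianization; rewrite mem_quotient.
Qed.

Section Generators.

Variables a1 a2 a3 : gT.

(** Here the equality of the three exponents enters: the abelianization is homocyclic, so every
    generating triple of [G] is a set of characteristic generators. *)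
Lemma gen_char_gens : <<[set a1; a2; a3]>> = G ->
  let c := coset G^`(1) in
  [/\ [/\ a1 \in G, a2 \in G & a3 \in G], <[c a1]> \x <[c a2]> \x <[c a3]> = Q
    & [/\ #[c a1] = n, #[c a2] = n & #[c a3] = n]].
Proof.
move=> genA c.
have [G1 G2 G3] : [/\ a1 \in G, a2 \in G & a3 \in G].
  by rewrite -genA; split; rewrite mem_gen // !inE eqxx ?orbT.
have genQ : <<[set c a1; c a2; c a3]>> = Q := quotient_gen3 (der_normal 1 G) genA.
by have [] := homocyclic3_dprod (der_abelian 0 G) card_abelianization
  exponent_abelianization genQ.
Qed.

Lemma char_gens_gen : a1 \in G -> a2 \in G -> a3 \in G ->
  <[coset G^`(1) a1]> \x <[coset G^`(1) a2]> \x <[coset G^`(1) a3]> = Q ->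
  <<[set a1; a2; a3]>> = G.
Proof.
move=> G1 G2 G3 dQ; apply: (gen_quotient_Phi (der_normal 1 G)) der_sub_Phi _ _ _ _ => //.
have [[H _ defH _] _ _ _] := dprodP dQ.
by rewrite -(dprodWY dQ) defH -(dprodWY defH) joing_cycle3.
Qed.

End Generators.

Lemma generators_exist : exists a1 a2 a3, <<[set a1; a2; a3]>> = G.
Proof.
have [b1 [b2 [b3 [dQ _ _ _]]]] := standing_basis.
have dQ' : <[b1]> \x <[b2]> \x <[b3]> = Q by rewrite -dprodA.
have genQ : <<[set b1; b2; b3]>> = Q.
  have [[H _ defH _] _ _ _] := dprodP dQ'.
  by rewrite -(dprodWY dQ') defH -(dprodWY defH) joing_cycle3.
have lift b : b \in [set b1; b2; b3] -> exists2 a, a \in G & b = coset G^`(1) a.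
  move=> Bb; have /morphimP[a _ Ga ->] : b \in Q by rewrite -genQ mem_gen.
  by exists a.
have [|a1 G1 E1] := lift b1; first by rewrite !inE eqxx.
have [|a2 G2 E2] := lift b2; first by rewrite !inE eqxx orbT.
have [|a3 G3 E3] := lift b3; first by rewrite !inE eqxx orbT.
by exists a1, a2, a3; apply: char_gens_gen; rewrite -?E1 -?E2 -?E3.
Qed.

End Standing.

(** * Commutators and powers in coordinates *)

Section ClassTwo.

Variables (gT : finGroupType) (G : {group gT}).
Hypothesis der_center : G^`(1) \subset 'Z(G).

Lemma comm_commute g h k : g \in G -> h \in G -> k \in G -> commute k [~ g, h].
Proof.
move=> Gg Gh Gk; have /(subsetP der_center)/setIP[_ /centP cG] : [~ g, h] \in G^`(1).
  by rewrite mem_commg.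
exact/commute_sym/cG.
Qed.

Lemma commMg2 g h k : g \in G -> h \in G -> k \in G ->
  [~ g * h, k] = [~ g, k] * [~ h, k].
Proof.
by move=> Gg Gh Gk; rewrite commMgJ /conjg -(comm_commute Gg Gk Gh) mulKg.
Qed.

Lemma commXg2 g k i : g \in G -> k \in G -> [~ g ^+ i, k] = [~ g, k] ^+ i.
Proof. by move=> Gg Gk; rewrite commXg //; apply: comm_commute. Qed.

Lemma comm_center f k : f \in 'Z(G) -> k \in G -> [~ f, k] = 1.
Proof. by case/setIP=> _ /centP cf Gk; apply/eqP/commgP/cf. Qed.

End ClassTwo.

Section Structure.

Variables (p m : nat) (gT : finGroupType) (G : {group gT}).
Hypotheses (p_prime : prime p) (p_odd : odd p).
Hypothesis standG : standing_group p m m m G.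

Local Notation n := (p ^ m)%N.

Let pG : p.-group G := sg_pgroup standG.
Let abelG' : p.-abelem G^`(1) := sg_der_abelem standG.
Let der_center := der_sub_center standG.

Let expG' x : x \in G^`(1) -> x ^+ p = 1.
Proof. by have [_] := abelemP p_prime abelG'; apply. Qed.

(** In class two, [(g * h) ^+ n] differs from [g ^+ n * h ^+ n] by [[~ h, g] ^+ 'C(n, 2)]; as [p] is
    odd, [p] divides this binomial coefficient. *)
Lemma expMg_exponent g h : g \in G -> h \in G -> (g * h) ^+ n = g ^+ n * h ^+ n.
Proof.
move=> Gg Gh; have cc k : k \in G -> commute k [~ h, g].
  by apply: comm_commute der_center _ _ _ Gh Gg.
rewrite (expMg_Rmul _ (cc _ Gh) (cc _ Gg)).
have m_gt0 : 0 < m by have [] := sg_exponents standG.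
have /dvdnP[k ->] : p %| 'C(n, 2).
  by rewrite bin2odd ?oddX ?p_odd ?orbT // dvdn_mulr // dvdn_exp.
by rewrite mulnC expgM expG' ?mem_commg // expg1n mulg1.
Qed.

(** The elements killed by the power map form a subgroup [K]. It contains the derived subgroup, of
    exponent [p], and all [p]-th powers, because [x ^+ n] lies in the derived subgroup. Hence the
    power map factors through [G / 'Phi(G)]. *)
Lemma expg_Phi f : f \in 'Phi(G) -> f ^+ n = 1.
Proof.
pose K := [set g in G | g ^+ n == 1].
have gK : group_set K.
  apply/group_setP; split; first by rewrite inE group1 expg1n eqxx.
  move=> g h; rewrite !inE => /andP[Gg /eqP gn] /andP[Gh /eqP hn].
  by rewrite groupM //= expMg_exponent // gn hn mulg1.
suff /subsetP sPhiK : 'Phi(G) \subset Group gK.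
  by move/sPhiK; rewrite inE => /andP[_ /eqP].
have m_gt0 : 0 < m by have [] := sg_exponents standG.
rewrite (Phi_joing pG) join_subG (MhoE 1 pG); apply/andP; split.
  apply/subsetP=> x Gx; rewrite inE (subsetP (der_sub 1 G)) //=.
  by rewrite -(prednK m_gt0) expnS expgM expG' // expg1n.
rewrite gen_subG; apply/subsetP=> _ /imsetP[x Gx ->]; rewrite inE groupX //= expn1.
by rewrite -expgM mulnC expgM expG' // expg_in_der.
Qed.

Section Generators.

Variables a1 a2 a3 : gT.
Hypothesis genA : <<[set a1; a2; a3]>> = G.

Local Notation x := [~ a2, a3].
Local Notation y := [~ a3, a1].
Local Notation z := [~ a1, a2].

Let Gs : [/\ a1 \in G, a2 \in G & a3 \in G].
Proof. by rewrite -genA; split; rewrite mem_gen // !inE eqxx ?orbT. Qed.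

Let G1 : a1 \in G. Proof. by have [] := Gs. Qed.
Let G2 : a2 \in G. Proof. by have [] := Gs. Qed.
Let G3 : a3 \in G. Proof. by have [] := Gs. Qed.

Let Gx : x \in G^`(1). Proof. exact: mem_commg. Qed.
Let Gy : y \in G^`(1). Proof. exact: mem_commg. Qed.
Let Gz : z \in G^`(1). Proof. exact: mem_commg. Qed.

Lemma word_Phi g : g \in G ->
  exists u : 'rV['F_p]_3, exists2 f, f \in 'Phi(G) & g = word a1 a2 a3 u * f.
Proof.
move=> Gg; have nG := subsetP (normal_norm (Phi_normal G)).
have genQ := quotient_gen3 (Phi_normal G) genA.
have [u uE] := word_surj p_prime (Phi_quotient_abelem pG) genQ (mem_quotient _ Gg).
have Gw : word a1 a2 a3 u \in G by apply: word_in.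
exists u, ((word a1 a2 a3 u)^-1 * g); last by rewrite mulKVg.
apply: coset_idr; first by rewrite groupM ?groupV ?nG.
by rewrite morphM ?morphV ?groupV ?nG //= word_morph ?nG // uE mulVg.
Qed.

Lemma comm_word (u : 'rV['F_p]_3) f k : f \in 'Phi(G) -> k \in G ->
  [~ word a1 a2 a3 u * f, k] = word [~ a1, k] [~ a2, k] [~ a3, k] u.
Proof.
move=> Pf Gk; have Gf := subsetP (Phi_sub G) _ Pf.
rewrite (commMg2 der_center) ?word_in //.
rewrite (comm_center (subsetP (sg_Phi standG) _ Pf)) // mulg1.
by rewrite !(commMg2 der_center) ?groupM ?groupX // !(commXg2 der_center).
Qed.

(** Factors in ['Phi(G)] are central and commutators are bilinear, so everything reduces to the
    commutators of the generators. *)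
Lemma comm_cross (u v : 'rV['F_p]_3) f h : f \in 'Phi(G) -> h \in 'Phi(G) ->
  [~ word a1 a2 a3 u * f, word a1 a2 a3 v * h] = word x y z (cross u v).
Proof.
move=> Pf Ph; have Gh := subsetP (Phi_sub G) _ Ph.
have Gvh : word a1 a2 a3 v * h \in G by rewrite groupM ?word_in.
have wN (t : 'rV['F_p]_3) : (word x y z t)^-1 = word x y z (- t)%R.
  by apply/eqP; rewrite eq_invg_mul -(wordD p_prime abelG') // subrr word0.
pose d i : 'rV['F_p]_3 := delta_mx 0%R i.
have xE : x = word x y z (d (inord 0)) by rewrite word_delta.
have yE : y = word x y z (d (inord 1)) by rewrite word_delta.
have zE : z = word x y z (d (inord 2)) by rewrite word_delta.
pose r (s0 s1 s2 : 'rV['F_p]_3) : 'rV['F_p]_3 :=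
  (- (v 0 (inord 0) *: s0 + v 0 (inord 1) *: s1 + v 0 (inord 2) *: s2))%R.
(* The right argument is expanded by inverting the commutator, hence the minus sign in [r]. *)
have colE a s0 s1 s2 : a \in G -> [~ a1, a] = word x y z s0 ->
    [~ a2, a] = word x y z s1 -> [~ a3, a] = word x y z s2 ->
    [~ a, word a1 a2 a3 v * h] = word x y z (r s0 s1 s2).
  move=> Ga e0 e1 e2; rewrite -invg_comm comm_word // e0 e1 e2 -wN.
  by rewrite !(wordD p_prime abelG') // !(wordZ p_prime abelG').
have e1 : [~ a1, word a1 a2 a3 v * h] = word x y z (r 0%R (- d (inord 2))%R (d (inord 1))).
  by apply: colE; rewrite ?commgg ?word0 // -wN -zE invg_comm.
have e2 : [~ a2, word a1 a2 a3 v * h] = word x y z (r (d (inord 2)) 0%R (- d (inord 0))%R).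
  by apply: colE; rewrite ?commgg ?word0 // -wN -xE invg_comm.
have e3 : [~ a3, word a1 a2 a3 v * h] = word x y z (r (- d (inord 1))%R (d (inord 0)) 0%R).
  by apply: colE; rewrite ?commgg ?word0 // -wN -yE invg_comm.
rewrite comm_word // e1 e2 e3 (word_lin p_prime abelG') //.
congr word; exact: cross_expand.
Qed.

Lemma der_word g : g \in G^`(1) -> exists v : 'rV['F_p]_3, g = word x y z v.
Proof.
have genD : <<[set x; y; z]>> = G^`(1).
  apply/eqP; rewrite eqEsubset gen_subG !subUset !sub1set Gx Gy Gz /=.
  rewrite gen_subG; apply/subsetP=> _ /imset2P[g1 h Gg Gh ->].
  have [u [f Pf ->]] := word_Phi Gg; have [v [k Pk ->]] := word_Phi Gh.
  by rewrite comm_cross // word_in ?mem_gen // !inE eqxx ?orbT.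
exact: word_surj genD.
Qed.

(** Words cover the derived subgroup, which has [p ^ 3] elements, as many as there are coordinate
    rows. *)
Lemma word_inj : injective (word x y z : 'rV['F_p]_3 -> gT).
Proof.
have imE : word x y z @: [set: 'rV['F_p]_3] = G^`(1).
  apply/eqP; rewrite eqEsubset; apply/andP; split.
    by apply/subsetP=> _ /imsetP[v _ ->]; rewrite word_in.
  by apply/subsetP=> g /der_word[v ->]; apply: imset_f.
have /imset_injP inj : #|word x y z @: [set: 'rV['F_p]_3]| == #|[set: 'rV['F_p]_3]|.
  by rewrite imE (sg_der_card standG) cardsT card_mx card_Fp.
by move=> u v; apply: inj; rewrite inE.
Qed.

Definition has_powers (w : 'M['F_p]_3) :=
  [/\ a1 ^+ n = word x y z (row (inord 0) w),
      a2 ^+ n = word x y z (row (inord 1) w)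
    & a3 ^+ n = word x y z (row (inord 2) w)].

(** The power map is a homomorphism killing ['Phi(G)], so on coordinates it is the linear map with
    matrix [w]. *)
Lemma expg_word w u f : has_powers w -> f \in 'Phi(G) ->
  (word a1 a2 a3 u * f) ^+ n = word x y z (u *m w)%R.
Proof.
move=> [e1 e2 e3] Pf; have Gf := subsetP (Phi_sub G) _ Pf.
rewrite expMg_exponent ?word_in // (expg_Phi Pf) mulg1.
rewrite !expMg_exponent ?groupM ?groupX // -!expgM ![(_ * n)%N]mulnC !expgM.
by rewrite -(word_comp p_prime abelG') // -e1 -e2 -e3.
Qed.

Lemma powers_exist : exists w, has_powers w.
Proof.
have [v1 e1] := der_word (expg_in_der standG G1).
have [v2 e2] := der_word (expg_in_der standG G2).
have [v3 e3] := der_word (expg_in_der standG G3).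
exists (\matrix_i nth 0 [:: v1; v2; v3] i)%R.
by split; rewrite rowK !inordK.
Qed.

End Generators.

End Structure.

(** * Change of generators as scaled congruence *)

Section Transition.

Variables (p m : nat) (gT : finGroupType) (G : {group gT}).
Hypotheses (p_prime : prime p) (p_odd : odd p).
Hypothesis standG : standing_group p m m m G.

Lemma char_matrixP a1 a2 a3 (w : 'M['F_p]_3) :
  char_matrix m m m G a1 a2 a3 w <->
  <<[set a1; a2; a3]>> = G /\ has_powers m a1 a2 a3 w.
Proof.
rewrite /has_powers /word !mxE; split=> [[[G1 G2 G3] dQ _ pw]|[genA pw]].
  by split=> //; apply: (char_gens_gen standG).
by have [? ? ?] := gen_char_gens standG genA; split.
Qed.

Let abelG' : p.-abelem G^`(1) := sg_der_abelem standG.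

Variables (a1 a2 a3 : gT) (w : 'M['F_p]_3).
Hypotheses (genA : <<[set a1; a2; a3]>> = G) (pwA : has_powers m a1 a2 a3 w).

Local Notation x := [~ a2, a3].
Local Notation y := [~ a3, a1].
Local Notation z := [~ a1, a2].

Let Gs : [/\ a1 \in G, a2 \in G & a3 \in G].
Proof. by rewrite -genA; split; rewrite mem_gen // !inE eqxx ?orbT. Qed.

Let Gxyz : [/\ x \in G^`(1), y \in G^`(1) & z \in G^`(1)].
Proof. by have [G1 G2 G3] := Gs; split; rewrite mem_commg. Qed.

Lemma comm_row_cofmx b1 b2 b3 (A : 'M['F_p]_3) f1 f2 f3 v :
  f1 \in 'Phi(G) -> f2 \in 'Phi(G) -> f3 \in 'Phi(G) ->
  b1 = word a1 a2 a3 (row (inord 0) A) * f1 ->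
  b2 = word a1 a2 a3 (row (inord 1) A) * f2 ->
  b3 = word a1 a2 a3 (row (inord 2) A) * f3 ->
  word [~ b2, b3] [~ b3, b1] [~ b1, b2] v = word x y z (v *m cofmx A)%R.
Proof.
move=> F1 F2 F3 -> -> ->; have [Gx Gy Gz] := Gxyz.
by rewrite !(comm_cross p_prime standG genA) // -!row_cofmx (word_comp p_prime abelG').
Qed.

(** Both sides are written in the old commutators x, y, z: the powers of the new generators have
    coordinates [A *m w], and the words in the new commutators have coordinates [w' *m cofmx A].
    Uniqueness of coordinates gives the equivalence. *)
Lemma has_powers_cofmx b1 b2 b3 (A w' : 'M['F_p]_3) f1 f2 f3 :
  f1 \in 'Phi(G) -> f2 \in 'Phi(G) -> f3 \in 'Phi(G) ->
  b1 = word a1 a2 a3 (row (inord 0) A) * f1 ->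
  b2 = word a1 a2 a3 (row (inord 1) A) * f2 ->
  b3 = word a1 a2 a3 (row (inord 2) A) * f3 ->
  has_powers m b1 b2 b3 w' <-> (A *m w = w' *m cofmx A)%R.
Proof.
move=> F1 F2 F3 e1 e2 e3.
have cE v := comm_row_cofmx v F1 F2 F3 e1 e2 e3.
rewrite /has_powers !cE -!row_mul e1 e2 e3.
rewrite !(expg_word p_prime p_odd standG genA _ pwA) // -!row_mul.
split=> [[p1 p2 p3]|->] //; apply/row_matrixP; elim/ord3P;
  exact: (word_inj p_prime standG genA).
Qed.

Lemma char_matrix_congr b1 b2 b3 (w' : 'M['F_p]_3) :
  <<[set b1; b2; b3]>> = G -> has_powers m b1 b2 b3 w' -> scaled_congr w w'.
Proof.
move=> genB pwB.
have [G1 G2 G3] : [/\ b1 \in G, b2 \in G & b3 \in G].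
  by rewrite -genB; split; rewrite mem_gen // !inE eqxx ?orbT.
have [u1 [f1 F1 e1]] := word_Phi p_prime standG genA G1.
have [u2 [f2 F2 e2]] := word_Phi p_prime standG genA G2.
have [u3 [f3 F3 e3]] := word_Phi p_prime standG genA G3.
pose A := (\matrix_i nth 0 [:: u1; u2; u3] (nat_of_ord i))%R : 'M['F_p]_3.
have r1 : row (inord 0) A = u1 by rewrite rowK inordK.
have r2 : row (inord 1) A = u2 by rewrite rowK inordK.
have r3 : row (inord 2) A = u3 by rewrite rowK inordK.
rewrite -r1 in e1; rewrite -r2 in e2; rewrite -r3 in e3.
have AE := (has_powers_cofmx w' F1 F2 F3 e1 e2 e3).1 pwB.
(* A row killed by [cofmx A] would be a relation between the commutators of the new generators,
   whose words are also injective. *)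
have uA : A \in unitmx.
  rewrite -cofmx_unit -row_free_unit -kermx_eq0; apply/eqP/row_matrixP=> i.
  rewrite row0; apply: (word_inj p_prime standG genB).
  rewrite (comm_row_cofmx _ F1 F2 F3 e1 e2 e3) -row_mul mulmx_ker row0.
  by rewrite !word0.
exists A, (\det A)^-1%R; split=> //; first by rewrite invr_eq0 -unitfE -unitmxE.
(* Multiplying the relation [A *m w = w' *m cofmx A] by [A^T] on the right isolates [w']. *)
have cofT : (cofmx A *m A^T = (\det A)%:M)%R.
  by apply: trmx_inj; rewrite trmx_mul trmxK -cofmxT -{1}[A]trmxK mul_tr_cofmx tr_scalar_mx det_tr.
rewrite AE -mulmxA cofT mul_mx_scalar scalerA mulVf ?scale1r //.
by rewrite -unitfE -unitmxE.
Qed.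

Lemma congr_char_matrix (w' : 'M['F_p]_3) : scaled_congr w w' ->
  exists b1 b2 b3, <<[set b1; b2; b3]>> = G /\ has_powers m b1 b2 b3 w'.
Proof.
move=> [A0 [l [uA0 l0 ->]]]; have [G1 G2 G3] := Gs.
have d0 : (\det A0 != 0)%R by rewrite -unitfE -unitmxE.
(* For [A = c *: A0] the new matrix is [(c * \det A0)^-1] times [A0 *m w *m A0^T]; this [c] makes
   the factor equal to [l]. *)
pose c := ((l * \det A0)^-1)%R; have c0 : (c != 0)%R by rewrite invr_eq0 mulf_neq0.
pose A := (c *: A0)%R.
have uA : A \in unitmx by rewrite unitmxZ // unitfE.
pose b i := word a1 a2 a3 (row (inord i) A).
have Gb i : b i \in G by apply: word_in.
exists (b 0), (b 1%N), (b 2); split; last first.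
  apply/(has_powers_cofmx (A := A) _ (group1 _) (group1 _) (group1 _)); rewrite ?mulg1 //.
  rewrite -[in RHS]scalemxAl -!mulmxA.
  have -> : (A0^T *m cofmx A = (c^-1 * \det A)%:M)%R.
    have -> : A0 = (c^-1 *: A)%R by rewrite scalerA mulVf ?scale1r.
    by rewrite linearZ /= -scalemxAl mul_tr_cofmx scale_scalar_mx.
  rewrite mul_mx_scalar -scalemxAr scalerA -scalemxAl; congr (_ *: _)%R.
  by rewrite detZ /c; field; rewrite d0 l0 oner_eq0.
(* The new elements generate [G] modulo ['Phi(G)], since [invmx A] expresses the old generators
   through them there. *)
pose k := coset 'Phi(G); have nG := subsetP (normal_norm (Phi_normal G)).
have abelQ := Phi_quotient_abelem (sg_pgroup standG).
have kE i : k (b i) = word (k a1) (k a2) (k a3) (row (inord i) A).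
  by rewrite /k word_morph ?nG.
have [K1 K2 K3] : [/\ k a1 \in G / 'Phi(G), k a2 \in G / 'Phi(G) & k a3 \in G / 'Phi(G)].
  by rewrite !mem_quotient.
apply: (@gen_quotient_Phi _ G 'Phi(G)%G); rewrite ?Phi_normal //.
apply/eqP; rewrite eqEsubset gen_subG !subUset !sub1set !mem_quotient //=.
have kword (v : 'rV['F_p]_3) :
    word (k a1) (k a2) (k a3) v \in <<[set k (b 0); k (b 1%N); k (b 2)]>>.
  rewrite -[v](mulmxKV uA) -(word_comp p_prime abelQ) // -!kE.
  by rewrite !groupM ?groupX // mem_gen // !inE eqxx ?orbT.
rewrite -(quotient_gen3 (Phi_normal G) genA) gen_subG !subUset !sub1set -/k.
have := (kword (delta_mx 0%R (inord 0)), kword (delta_mx 0%R (inord 1)),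
  kword (delta_mx 0%R (inord 2))).
by rewrite !word_delta // => -[[-> ->] ->].
Qed.

End Transition.

(** * Transport along isomorphisms and the classification *)

Lemma char_matrix_isog (p m : nat) (gT hT : finGroupType) (G : {group gT})
    (H : {group hT}) a1 a2 a3 (w : 'M['F_p]_3) :
  prime p -> standing_group p m m m G -> standing_group p m m m H ->
  G \isog H -> char_matrix m m m G a1 a2 a3 w ->
  exists b1 b2 b3, char_matrix m m m H b1 b2 b3 w.
Proof.
move=> p_prime sG sH /isogP[f _ fG] /(char_matrixP sG)[genA [p1 p2 p3]].
have [G1 G2 G3] : [/\ a1 \in G, a2 \in G & a3 \in G].
  by rewrite -genA; split; rewrite mem_gen // !inE eqxx ?orbT.
exists (f a1), (f a2), (f a3); apply/(char_matrixP sH); split.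
  transitivity (f @* <<[set a1; a2; a3]>>); last by rewrite genA.
  rewrite morphim_gen; first by rewrite !morphimU !morphim_set1.
  by rewrite -genA subset_gen.
by split; rewrite -!morphR // -word_morph ?groupR // -?p1 -?p2 -?p3 morphX.
Qed.

Local Close Scope group_scope.
Local Open Scope ring_scope.

Theorem theorem6p1 (p : nat) (p_prime : prime p) (p_odd : odd p)
    (eta : 'F_p) (eta_nonsquare : forall u : 'F_p, u ^+ 2 <> eta) :
  (forall (m : nat) (gT : finGroupType) (G : {group gT}),
     standing_group p m m m G ->
     exists (t : matrix_type p) (a1 a2 a3 : gT),
       valid_type eta t /\ char_matrix m m m G a1 a2 a3 (type_matrix t))
  /\
  (forall (m n : nat) (gT hT : finGroupType)
          (G : {group gT}) (H : {group hT})
          (a1 a2 a3 : gT) (b1 b2 b3 : hT) (s t : matrix_type p),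
     standing_group p m m m G -> standing_group p n n n H ->
     valid_type eta s -> valid_type eta t ->
     char_matrix m m m G a1 a2 a3 (type_matrix s) ->
     char_matrix n n n H b1 b2 b3 (type_matrix t) ->
     s <> t -> ~~ (G \isog H)).
Proof.
split=> [m gT G sG|m n gT hT G H a1 a2 a3 b1 b2 b3 s t sG sH vs vt aG bH st].
  have [a1 [a2 [a3 genA]]] := generators_exist sG.
  have [w pw] := powers_exist p_prime sG genA.
  have [t vt E] := scaled_congr_type p_prime p_odd eta_nonsquare w.
  have [b1 [b2 [b3 B]]] := congr_char_matrix p_prime p_odd sG genA pw E.
  by exists t, b1, b2, b3; split; last by apply/(char_matrixP sG).
apply/negP=> isoGH; apply: st.
(* The order of [G] is [p ^ 3 * p ^ (3 * m)], which determines [m]. *)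
have mn : m = n.
  have := card_isog isoGH.
  rewrite -(Lagrange (der_sub 1 G)) -(Lagrange (der_sub 1 H)).
  rewrite (sg_der_card sG) (sg_der_card sH) -!card_quotient ?der_norm //.
  rewrite (card_abelianization sG) (card_abelianization sH).
  move/eqP; rewrite eqn_pmul2l ?expn_gt0 ?prime_gt0 // -!expnD eqn_exp2l ?prime_gt1 //.
  by move/eqP=> E; lia.
(* The matrix of [G] is carried over to [H], so that [H] has characteristic matrices of both types
   and these are congruent up to a scalar. *)
rewrite -mn in sH bH; have [c1 [c2 [c3 cH]]] := char_matrix_isog p_prime sG sH isoGH aG.
have [genC pwC] := (char_matrixP sH _ _ _ _).1 cH.
have [genB pwB] := (char_matrixP sH _ _ _ _).1 bH.
apply: (scaled_congr_type_inj p_prime p_odd eta_nonsquare vs vt).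
exact: (char_matrix_congr p_prime p_odd sH genC pwC genB pwB).
Qed.
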